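(* Let $a,b,c$ be positive numbers with $\delta=a+b-c\in(0,1)$, and suppose that the shifted hypergeometric function $f(z)=z\,{}_2F_1(a,b;c;z)$ is convex on $\mathbb{D}$. Then the image $f(\mathbb{D})$ is contained in the sector $S=\{z:|\arg(z-B)|<\pi\delta/2\}$ and the boundary of $S$ is contained in the union of asymptotic lines of the boundary of $f(\mathbb{D})$, where $B=\dfrac{\Gamma(c)\Gamma(-\delta)}{\Gamma(c-a)\Gamma(c-b)}$. Moreover, the choice of the sector $S$ is optimal.
   Context: $\mathbb{D}=\{z\in\mathbb{C}:|z|<1\}$, and $\Gamma$ is the Gamma function (with $1/\Gamma(0)=0$). For real $a,b,c$ with $c\neq 0,-1,-2,\dots$, ${}_2F_1(a,b;c;z)=\sum_{n=0}^\infty \frac{(a)_n(b)_n}{(c)_n n!}z^n$ for $|z|<1$, where $(a)_0=1$ and $(a)_n=a(a+1)\cdots(a+n-1)$ for $n\ge1$; from inside $\mathbb{D}$ it extends continuously to $\overline{\mathbb{D}}\setminus\{1\}$. An analytic function $f$ on $\mathbb{D}$ with $f(0)=f'(0)-1=0$ is called convex if $f$ is univalent on $\mathbb{D}$ and $f(\mathbb{D})$ is a convex domain. The boundary of $f(\mathbb{D})$ is parametrized by $\gamma(\theta)=f(e^{i\theta})$, $0<\theta<2\pi$; a line $\ell$ is an asymptotic line of the boundary if $\gamma(\theta)\to\infty$ and $\operatorname{dist}(\gamma(\theta),\ell)\to0$ as $\theta\to0^+$ or as $\theta\to2\pi^-$. *)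

(* Defs.v *)
From Stdlib Require Import Reals Factorial.
From Coquelicot Require Import Coquelicot.
Open Scope R_scope.

Fixpoint pochhammer (x : R) (n : nat) : R :=
  match n with
  | O => 1
  | S m => pochhammer x m * (x + INR m)
  end.

(* Euler's limit, taken as the definition of the Gamma function as in
   Andrews-Askey-Roy, "Special Functions", Definition 1.1.1; it is meaningful
   for every real x other than 0, -1, -2, ... *)
Definition Gamma (x : R) : R :=
  real (Lim_seq (fun k =>
    INR (fact k) * Rpower (INR k) (x - 1) / pochhammer x k)).

(* Reciprocal Gamma function on x > -1, where 0 is the only pole of Gamma. *)
Definition rGamma (x : R) : R :=
  if Req_EM_T x 0 then 0 else / Gamma x.

(* Meaningful for |z| < 1 only: [iota] picks the sum when the series converges. *)
Definition hyp2F1 (a b c : R) (z : C) : C :=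
  iota (T := C_CompleteNormedModule)
    (is_series (K := C_AbsRing) (V := C_NormedModule)
      (fun n => Cmult (RtoC (pochhammer a n * pochhammer b n
                             / (pochhammer c n * INR (fact n))))
                      (Cpow z n))).

Definition shifted_hyp2F1 (a b c : R) (z : C) : C :=
  Cmult z (hyp2F1 a b c z).

Definition unit_disk (z : C) : Prop := Cmod z < 1.

Definition image_of_disk (f : C -> C) (w : C) : Prop :=
  exists z : C, unit_disk z /\ f z = w.

Definition subset (E F : C -> Prop) : Prop := forall z : C, E z -> F z.

(* Complex differentiability at every point of the (open) disk. *)
Definition analytic_on_disk (f : C -> C) : Prop :=
  forall z : C, unit_disk z ->
    ex_derive (K := C_AbsRing) (V := C_NormedModule) f z.

Definition univalent_on_disk (f : C -> C) : Prop :=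
  forall z w : C, unit_disk z -> unit_disk w -> f z = f w -> z = w.

(* Connectedness of the domain E follows from its convexity. *)
Definition convex_domain (E : C -> Prop) : Prop :=
  open (T := C_UniformSpace) E /\
  (exists z : C, E z) /\
  (forall (z w : C) (t : R), E z -> E w -> 0 <= t <= 1 ->
     E (Cplus (Cmult (RtoC (1 - t)) z) (Cmult (RtoC t) w))).

Definition convex_function (f : C -> C) : Prop :=
  analytic_on_disk f /\
  f (RtoC 0) = RtoC 0 /\
  is_derive (K := C_AbsRing) (V := C_NormedModule) f (RtoC 0) (RtoC 1) /\
  univalent_on_disk f /\
  convex_domain (image_of_disk f).

Definition cis (t : R) : C := (cos t, sin t).

(* t is the principal argument of z, which 0 does not have. *)
Definition is_arg (z : C) (t : R) : Prop :=
  z <> RtoC 0 /\ - PI < t <= PI /\ z = Cmult (RtoC (Cmod z)) (cis t).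

(* Open sector with vertex p, axis direction u <> 0 and opening angle 2 * alpha:
   |arg ((z - p) / u)| < alpha. *)
Definition sector (p u : C) (alpha : R) (z : C) : Prop :=
  exists t : R, is_arg (Cdiv (Cminus z p) u) t /\ Rabs t < alpha.

Definition boundary (E : C -> Prop) (z : C) : Prop :=
  forall eps : R, 0 < eps ->
    (exists w : C, E w /\ Cmod (Cminus w z) < eps) /\
    (exists w : C, ~ E w /\ Cmod (Cminus w z) < eps).

Definition is_line (L : C -> Prop) : Prop :=
  exists p u : C, u <> RtoC 0 /\
    forall z : C, L z <-> exists t : R, z = Cplus p (Cmult (RtoC t) u).

Definition dist_to (z : C) (E : C -> Prop) : R :=
  real (Glb_Rbar (fun r => exists w : C, E w /\ r = Cmod (Cminus z w))).

(* gamma theta is the value at e^(i theta) of the continuous extension of f to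
   the closed disk deprived of 1, that is, the limit of f from inside the disk. *)
Definition boundary_curve (f : C -> C) (gamma : R -> C) : Prop :=
  forall theta : R, 0 < theta < 2 * PI ->
    filterlim f
      (within unit_disk (locally (T := C_UniformSpace) (cis theta)))
      (locally (T := C_UniformSpace) (gamma theta)).

Definition asymptotic_along
    (F : (R -> Prop) -> Prop) (gamma : R -> C) (L : C -> Prop) : Prop :=
  filterlim (fun theta => Cmod (gamma theta)) F (Rbar_locally p_infty) /\
  filterlim (fun theta => dist_to (gamma theta) L) F (locally 0).

Definition asymptotic_line (f : C -> C) (L : C -> Prop) : Prop :=
  is_line L /\
  exists gamma : R -> C,
    boundary_curve f gamma /\
    (asymptotic_along (at_right 0) gamma L \/
     asymptotic_along (at_left (2 * PI)) gamma L).

(* The sector (p, u, alpha) cannot be replaced by a smaller one containing E: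
   a sector that contains E, and is contained in the given sector or has no
   larger opening, already contains the given sector.  The vertex, the axis and
   the opening of the competing sector are all free. *)
Definition optimal_sector (E : C -> Prop) (p u : C) (alpha : R) : Prop :=
  forall (q v : C) (beta : R),
    v <> RtoC 0 -> 0 < beta <= PI ->
    subset E (sector q v beta) ->
    subset (sector q v beta) (sector p u alpha) \/ beta <= alpha ->
    subset (sector p u alpha) (sector q v beta).

(* Main.v *)
Require Import Defs.
From Stdlib Require Import Reals Factorial Lra Lia.
From Coquelicot Require Import Coquelicot.
Open Scope R_scope.

(** Write [d] for [delta] and [al = PI d / 2].  The theorem rests on the expansion of
    [f] at its singular point [1],

      [f z = B + K (1 - z)^(-d) + o(1)],   [K > 0],

    valid as [z] tends to [1] inside the closed disk.  There [1 - z] has positive real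
    part, so [(1 - z)^(-d)] has argument strictly between [-al] and [al], and the
    arguments [al] and [-al] are approached along the two ends of the unit circle.

    The expansion.  The quotient of the Taylor coefficients [t_n] of the hypergeometric
    function by the coefficients [d_n] of [(1 - z)^(-d)] is a quotient of Pochhammer
    symbols in which Euler's products for Gamma can be recognised; it converges to some
    [K > 0] at rate [1/n] ([hyp_coef_asymptotics]).  Since the series of [d_n / n]
    telescopes, the remainders [t_n - K d_n] are absolutely summable, and their power
    series is continuous on the whole closed disk.  Gauss's contiguity relation, iterated
    in the parameter [c], evaluates its value at [1] to be [B] ([hyp_coef_remainder]).
    The binomial series is identified with the principal power by a differential
    equation along radii ([binomial_series]).

    Inclusion.  Let [l] be the real linear form vanishing on an edge of the sector and
    negative inside it.  Suppose [l (w0 - B) > 0] for a value [w0] of [f].  There are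
    values [w1] of [f] far away along the edge with [l (w1 - B)] close to [0].  By
    convexity the midpoint of [w0] and [w1] is again a value [f z2], it is large, and
    [l] is bounded away from [0] on it.  But [f] is bounded away from [1], so [z2] is
    close to [1], and there the expansion makes [l] at most slightly positive: a
    contradiction ([convex_image_in_side]).  Openness of the image excludes
    [l (w0 - B) = 0].

    Asymptotic lines.  On the unit circle [(1 - z)^(-d)] is at distance [O(th^(1-d))]
    from the ray of argument [al] or [-al] ([cpower_circle]), and [1 - d > 0].

    Optimality.  A sector contained in the given one is not wider than it
    ([sector_opening_le]), and a sector of opening less than [PI] is an intersection of
    two half-planes.  Half-planes containing the image contain, up to translation, both
    asymptotic directions, and if an asymptotic ray is parallel to their edge they
    contain [B] in their closure ([half_plane_ray]).  This forces the axis and the opening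
    of a competing sector, and puts [B] inside its closure
    ([asymptotic_sector_optimal]). *)

(** * Euler's limit for the Gamma function *)

Lemma is_series_telescope (u : nat -> R) (l : R) :
  is_lim_seq u l -> is_series (fun n => u n - u (S n)) (u O - l).
Proof.
  intros Hu.
  change (is_lim_seq (sum_n (fun n => u n - u (S n))) (u O - l)).
  apply (is_lim_seq_ext (fun n => u O - u (S n))).
  - intros n; induction n as [|n IH].
    + rewrite sum_O; reflexivity.
    + rewrite sum_Sn, <- IH; unfold plus; simpl; ring.
  - apply (is_lim_seq_minus _ _ (u O) l (u O - l)).
    + apply is_lim_seq_const.
    + now apply is_lim_seq_incr_1 in Hu.
    + reflexivity.
Qed.

Lemma is_lim_seq_inv_S : is_lim_seq (fun n => / INR (S n)) 0.
Proof.
  apply (is_lim_seq_incr_1 (fun n => / INR n)).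
  apply (is_lim_seq_inv _ p_infty); [apply is_lim_seq_INR|discriminate].
Qed.

Lemma INR_S_pos n : 0 < INR (S n).
Proof. apply lt_0_INR; lia. Qed.

Lemma inv_sq_le_telescope n :
  / (INR (S n) * INR (S n)) <= 2 * (/ INR (S n) - / INR (S (S n))).
Proof.
  assert (H := INR_S_pos n); rewrite (S_INR (S n)).
  assert (H1 : 1 <= INR (S n)) by (rewrite S_INR; assert (H2 := pos_INR n); lra).
  apply Rminus_le.
  replace (/ (INR (S n) * INR (S n)) - 2 * (/ INR (S n) - / (INR (S n) + 1)))
    with ((1 - INR (S n)) / (INR (S n) * INR (S n) * (INR (S n) + 1)))
    by (field; lra).
  apply Rmult_le_0_r; [lra|].
  left; apply Rinv_0_lt_compat; nra.
Qed.

Lemma ex_series_inv_sq : ex_series (fun n => / (INR (S n) * INR (S n))).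
Proof.
  apply (ex_series_le (K := R_AbsRing) (V := R_CompleteNormedModule) _
           (fun n => 2 * (/ INR (S n) - / INR (S (S n))))).
  - intros n; change norm with Rabs.
    assert (H := INR_S_pos n).
    rewrite Rabs_pos_eq; [apply inv_sq_le_telescope|].
    left; apply Rinv_0_lt_compat; nra.
  - apply (ex_series_scal (K := R_AbsRing) (V := R_NormedModule) 2
             (fun n => / INR (S n) - / INR (S (S n)))).
    exists (/ INR 1 - 0).
    exact (is_series_telescope (fun n => / INR (S n)) 0 is_lim_seq_inv_S).
Qed.

(** Both bounds on the logarithm come from [exp x >= 1 + x], applied to
    [ln (1 + y)] and to its opposite. *)
Lemma Rabs_ln_sub_le (y : R) : Rabs y <= / 2 -> Rabs (ln (1 + y) - y) <= 2 * (y * y).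
Proof.
  intros Hy; apply Rabs_le_between in Hy.
  assert (H1 : ln (1 + y) <= y).
  { assert (H := exp_ineq1_le (ln (1 + y))); rewrite exp_ln in H; lra. }
  assert (H2 : 1 - / (1 + y) <= ln (1 + y)).
  { assert (H := exp_ineq1_le (- ln (1 + y))).
    rewrite exp_Ropp, exp_ln in H; lra. }
  assert (H3 : 1 - / (1 + y) = y - y * y / (1 + y)) by (field; lra).
  assert (H4 : y * y / (1 + y) <= 2 * (y * y)).
  { apply Rle_div_l; nra. }
  apply Rabs_le; nra.
Qed.

(** Here [u n] is [u O] times the exponential of a partial sum of [e]; the limit has
    the sign of [u O], and vanishes only with it. *)
Lemma is_lim_seq_exp_product (u e : nat -> R) :
  (forall n, u (S n) = u n * exp (e n)) -> ex_series e ->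
  is_lim_seq u (u O * exp (Series e)).
Proof.
  intros Hu He.
  apply is_lim_seq_incr_1.
  apply (is_lim_seq_ext (fun n => u O * exp (sum_n e n))).
  - intros n; induction n as [|n IH].
    + rewrite sum_O, Hu; reflexivity.
    + rewrite sum_Sn, (Hu (S n)), <- IH.
      unfold plus; simpl; rewrite exp_plus; ring.
  - apply (is_lim_seq_scal_l _ _ (exp (Series e))).
    apply is_lim_seq_continuous.
    + apply derivable_continuous_pt, derivable_pt_exp.
    + exact (Series_correct e He).
Qed.

Lemma pochhammer_pos (x : R) (n : nat) : 0 < x -> 0 < pochhammer x n.
Proof.
  intros Hx; induction n as [|n IH]; simpl; [lra|].
  assert (H := pos_INR n); nra.
Qed.

Lemma pochhammer_neq_0 (x : R) (n : nat) : -1 < x -> x <> 0 -> pochhammer x n <> 0.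
Proof.
  intros Hx Hx0; induction n as [|n IH]; simpl; [lra|].
  apply Rmult_integral_contrapositive_currified; [exact IH|].
  destruct n as [|n]; [simpl; lra|].
  rewrite S_INR; assert (H := pos_INR n); lra.
Qed.

Lemma pochhammer_0 (n : nat) : pochhammer 0 (S n) = 0.
Proof.
  induction n as [|n IH].
  - simpl; ring.
  - change (pochhammer 0 (S n) * (0 + INR (S n)) = 0); rewrite IH; ring.
Qed.

Lemma pochhammer_shift (x : R) (n : nat) :
  pochhammer x (S n) = x * pochhammer (x + 1) n.
Proof.
  induction n as [|n IH].
  - simpl; ring.
  - change (pochhammer x (S n) * (x + INR (S n))
            = x * (pochhammer (x + 1) n * (x + 1 + INR n))).
    rewrite IH, S_INR; ring.
Qed.

(** The sequence whose limit defines [Gamma]. *)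
Definition euler_gamma (x : R) (k : nat) : R :=
  INR (fact k) * Rpower (INR k) (x - 1) / pochhammer x k.

(** The ratio of consecutive terms is [(1 + 1/k)^x / (1 + x/k)], whose logarithm
    is [O(1/k^2)]. *)
Lemma euler_gamma_lim (x : R) : -1 < x -> x <> 0 ->
  exists l : R, is_lim_seq (euler_gamma x) l /\ l <> 0 /\ (0 < x -> 0 < l).
Proof.
  intros Hx Hx0.
  (* From this rank on, [1/k] and [x/k] are at most [1/2] in absolute value. *)
  destruct (INR_unbounded (2 * (1 + Rabs x))) as [N HN].
  assert (HNpos : 0 < INR N) by (assert (H := Rabs_pos x); lra).
  set (e := fun n => x * ln (1 + / INR (S n)) - ln (1 + x / INR (S n))).
  set (u := fun n => euler_gamma x (S N + n)).
  set (e' := fun n => e (N + n)%nat).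
  assert (Hinv : forall n, / INR (S (N + n)) <= / (2 * (1 + Rabs x))
                           /\ 0 < INR (S (N + n))).
  { intros n; assert (H := Rabs_pos x); split; [|apply INR_S_pos].
    apply Rinv_le_contravar; [lra|].
    rewrite S_INR, plus_INR; assert (H1 := pos_INR n); lra. }
  assert (Hsmall : forall n, Rabs (/ INR (S (N + n))) <= / 2
                             /\ Rabs (x / INR (S (N + n))) <= / 2).
  { intros n; destruct (Hinv n) as [H1 H2]; assert (H := Rabs_pos x).
    assert (Hi := Rinv_0_lt_compat _ H2).
    unfold Rdiv; rewrite Rabs_mult, !(Rabs_pos_eq (/ _)) by lra.
    rewrite Rinv_mult in H1.
    assert (H3 : / (1 + Rabs x) <= 1)
      by (rewrite <- Rinv_1; apply Rinv_le_contravar; lra).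
    assert (H4 : Rabs x * / (1 + Rabs x) <= 1).
    { apply Rle_div_l; lra. }
    split; [lra|].
    apply Rle_trans with (Rabs x * (/ 2 * / (1 + Rabs x))).
    - apply Rmult_le_compat_l; lra.
    - lra. }
  assert (Hu : forall n, u (S n) = u n * exp (e' n)).
  { intros n; unfold u, e', e, euler_gamma.
    replace (S N + S n)%nat with (S (S (N + n))) by lia.
    replace (S N + n)%nat with (S (N + n)) by lia.
    destruct (Hinv n) as [_ HP]; destruct (Hsmall n) as [HS1 HS2].
    set (m := S (N + n)) in *.
    assert (Hi := Rinv_0_lt_compat _ HP).
    apply Rabs_le_between in HS2.
    assert (Hp : pochhammer x m <> 0) by (apply pochhammer_neq_0; lra).
    assert (Hxm : 0 < INR m + x).
    { assert (H := Rmult_lt_0_compat (INR m) (1 + x / INR m) HP ltac:(lra)).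
      replace (INR m * (1 + x / INR m)) with (INR m + x) in H by (field; lra).
      exact H. }
    change (pochhammer x (S m)) with (pochhammer x m * (x + INR m)).
    rewrite fact_simpl, mult_INR, S_INR.
    unfold Rminus; rewrite exp_plus, exp_Ropp.
    rewrite (exp_ln (1 + x / INR m)) by lra.
    replace (1 + / INR m) with ((INR m + 1) * / INR m) by (field; lra).
    rewrite ln_mult, ln_Rinv by lra.
    unfold Rpower.
    replace (x * (ln (INR m + 1) + - ln (INR m)))
      with ((x + - (1)) * ln (INR m + 1) + - ((x + - (1)) * ln (INR m))
            + ln (INR m + 1) + - ln (INR m)) by ring.
    rewrite !exp_plus, !exp_Ropp, !exp_ln by lra.
    field; repeat split; try lra; apply Rgt_not_eq, exp_pos. }
  assert (He : ex_series e').
  { apply (ex_series_le (K := R_AbsRing) (V := R_CompleteNormedModule) _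
             (fun n => 2 * (Rabs x + x * x) * / (INR (S (N + n)) * INR (S (N + n))))).
    - intros n; change norm with Rabs.
      destruct (Hinv n) as [_ HP]; destruct (Hsmall n) as [HS1 HS2].
      apply Rabs_ln_sub_le in HS1; apply Rabs_ln_sub_le in HS2.
      unfold e', e.
      replace (x * ln (1 + / INR (S (N + n))) - ln (1 + x / INR (S (N + n))))
        with (x * (ln (1 + / INR (S (N + n))) - / INR (S (N + n)))
              - (ln (1 + x / INR (S (N + n))) - x / INR (S (N + n))))
        by (field; lra).
      eapply Rle_trans; [apply Rabs_triang|].
      rewrite Rabs_Ropp, Rabs_mult.
      apply Rle_trans with
        (Rabs x * (2 * (/ INR (S (N + n)) * / INR (S (N + n))))
         + 2 * (x / INR (S (N + n)) * (x / INR (S (N + n))))).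
      + apply Rplus_le_compat; [|exact HS2].
        apply Rmult_le_compat_l; [apply Rabs_pos|exact HS1].
      + right; field; lra.
    - apply (ex_series_scal (K := R_AbsRing) (V := R_NormedModule) (2 * (Rabs x + x * x))
               (fun n => / (INR (S (N + n)) * INR (S (N + n))))).
      exact (proj1 (ex_series_incr_n _ N) ex_series_inv_sq). }
  exists (u O * exp (Series e')).
  assert (Hu0 : u O <> 0 /\ (0 < x -> 0 < u O)).
  { unfold u, euler_gamma.
    assert (H1 : 0 < INR (fact (S N + 0)) * Rpower (INR (S N + 0)) (x - 1))
      by (apply Rmult_lt_0_compat; [apply INR_fact_lt_0|apply exp_pos]).
    split.
    - apply Rmult_integral_contrapositive_currified; [lra|].
      apply Rinv_neq_0_compat, pochhammer_neq_0; lra.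
    - intros H; apply Rdiv_lt_0_compat; [exact H1|].
      now apply pochhammer_pos. }
  assert (Hexp := exp_pos (Series e')).
  split; [|split].
  - apply (is_lim_seq_incr_n _ (S N)).
    apply (is_lim_seq_ext u).
    { intros n; unfold u; f_equal; lia. }
    now apply is_lim_seq_exp_product.
  - apply Rmult_integral_contrapositive_currified; [apply Hu0|lra].
  - intros H; apply Rmult_lt_0_compat; [now apply Hu0|lra].
Qed.

Lemma Gamma_correct (x : R) : -1 < x -> x <> 0 ->
  is_lim_seq (euler_gamma x) (Gamma x) /\ Gamma x <> 0 /\ (0 < x -> 0 < Gamma x).
Proof.
  intros Hx Hx0; destruct (euler_gamma_lim x Hx Hx0) as [l [Hl Hl0]].
  replace (Gamma x) with l; [now split|].
  unfold Gamma; fold (euler_gamma x).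
  now rewrite (is_lim_seq_unique _ _ Hl).
Qed.

(** In the quotient of the four Euler sequences the factorials cancel, and so do
    the powers of [n], because their exponents have the same sum. *)
Lemma pochhammer_quotient_lim (x y u v : R) :
  x + y = u + v -> -1 < x -> -1 < y -> -1 < u -> u <> 0 -> -1 < v -> v <> 0 ->
  is_lim_seq
    (fun n => pochhammer x n * pochhammer y n / (pochhammer u n * pochhammer v n))
    (Gamma u * Gamma v * (rGamma x * rGamma y)).
Proof.
  intros Hs Hx Hy Hu Hu0 Hv Hv0.
  unfold rGamma.
  destruct (Req_EM_T x 0) as [->|Hx0]; [|destruct (Req_EM_T y 0) as [->|Hy0]].
  1, 2: apply is_lim_seq_incr_1, (is_lim_seq_ext (fun _ => 0));
    [intros n; rewrite pochhammer_0; unfold Rdiv; ring|].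
  1, 2: rewrite ?Rmult_0_l, ?Rmult_0_r; apply is_lim_seq_const.
  destruct (Gamma_correct x Hx Hx0) as [Lx [Gx _]].
  destruct (Gamma_correct y Hy Hy0) as [Ly [Gy _]].
  destruct (Gamma_correct u Hu Hu0) as [Lu _].
  destruct (Gamma_correct v Hv Hv0) as [Lv _].
  apply is_lim_seq_incr_1.
  apply (is_lim_seq_ext
    (fun n => euler_gamma u (S n) * euler_gamma v (S n)
              / (euler_gamma x (S n) * euler_gamma y (S n)))).
  - intros n; unfold euler_gamma.
    assert (Hpx := pochhammer_neq_0 x (S n) Hx Hx0).
    assert (Hpy := pochhammer_neq_0 y (S n) Hy Hy0).
    assert (Hpu := pochhammer_neq_0 u (S n) Hu Hu0).
    assert (Hpv := pochhammer_neq_0 v (S n) Hv Hv0).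
    assert (Hf := INR_fact_neq_0 (S n)).
    assert (Hpow : Rpower (INR (S n)) (u - 1) * Rpower (INR (S n)) (v - 1)
                   = Rpower (INR (S n)) (x - 1) * Rpower (INR (S n)) (y - 1)).
    { rewrite <- !Rpower_plus; f_equal; lra. }
    assert (Hx1 : Rpower (INR (S n)) (x - 1) <> 0) by apply Rgt_not_eq, exp_pos.
    assert (Hy1 : Rpower (INR (S n)) (y - 1) <> 0) by apply Rgt_not_eq, exp_pos.
    apply Rmult_eq_reg_r with
      (Rpower (INR (S n)) (x - 1) * Rpower (INR (S n)) (y - 1)).
    2: now apply Rmult_integral_contrapositive_currified.
    rewrite <- Hpow at 2.
    field; repeat split; assumption.
  - apply is_lim_seq_incr_1 in Lx; apply is_lim_seq_incr_1 in Ly.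
    apply is_lim_seq_incr_1 in Lu; apply is_lim_seq_incr_1 in Lv.
    replace (Gamma u * Gamma v * (/ Gamma x * / Gamma y))
      with (Gamma u * Gamma v / (Gamma x * Gamma y)) by (field; now split).
    apply is_lim_seq_div'.
    + now apply is_lim_seq_mult'.
    + now apply is_lim_seq_mult'.
    + now apply Rmult_integral_contrapositive_currified.
Qed.

(** * Series depending on a parameter *)

(** Tannery's theorem: the tails are uniformly small, and the partial sums
    converge term by term. *)
Lemma filterlim_Series {T : Type} {F : (T -> Prop) -> Prop} {FF : Filter F}
    (phi : T -> nat -> R) (l M : nat -> R) :
  ex_series M ->
  (forall n, Rabs (l n) <= M n) ->
  F (fun x => forall n, Rabs (phi x n) <= M n) ->
  (forall n, filterlim (fun x => phi x n) F (locally (l n))) ->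
  filterlim (fun x => Series (phi x)) F (locally (Series l)).
Proof.
  intros HM Hl Hphi Hlim.
  assert (Hdom : forall p : nat -> R, (forall n, Rabs (p n) <= M n) -> ex_series p).
  { intros p Hp.
    apply (ex_series_le (K := R_AbsRing) (V := R_CompleteNormedModule) p M); assumption. }
  assert (Htail : forall p : nat -> R, (forall n, Rabs (p n) <= M n) -> forall N,
    Rabs (Series p - sum_n p N) <= Series M - sum_n M N).
  { intros p Hp N.
    rewrite (Series_incr_n p (S N)), (Series_incr_n M (S N)) by (lia || auto).
    simpl pred; rewrite <- !sum_n_Reals.
    replace (_ + _ - sum_n p N) with (Series (fun k => p (S N + k)%nat)) by ring.
    replace (_ + _ - sum_n M N) with (Series (fun k => M (S N + k)%nat)) by ring.
    assert (Hs : ex_series (fun k => M (S N + k)%nat)) by now apply (ex_series_incr_n M).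
    eapply Rle_trans; [apply Series_Rabs|].
    - apply (ex_series_le (K := R_AbsRing) (V := R_CompleteNormedModule) _
               (fun k => M (S N + k)%nat)); [|exact Hs].
      intros n; change norm with Rabs; rewrite Rabs_Rabsolu; apply Hp.
    - apply Series_le; [|exact Hs].
      intros n; split; [apply Rabs_pos|apply Hp]. }
  apply filterlim_locally; intros eps.
  assert (Heps : 0 < eps / 3) by (destruct eps; simpl; lra).
  assert (HN : exists N, Series M - sum_n M N < eps / 3).
  { assert (H := Series_correct M HM).
    destruct (proj1 (filterlim_locally (U := R_UniformSpace) (sum_n M) (Series M)) H
                (mkposreal _ Heps)) as [N HN].
    exists N; specialize (HN N (le_n N)).
    unfold ball in HN; simpl in HN; unfold AbsRing_ball, abs, minus, plus, opp in HN.
    simpl in HN; apply Rabs_lt_between in HN; lra. }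
  destruct HN as [N HN].
  assert (Hsum : filterlim (fun x => sum_n (phi x) N) F (locally (sum_n l N))).
  { clear HN; induction N as [|N IH].
    - rewrite sum_O; eapply filterlim_ext; [|apply (Hlim O)].
      intros x; now rewrite sum_O.
    - rewrite sum_Sn.
      apply filterlim_ext with (fun x => plus (sum_n (phi x) N) (phi x (S N))).
      + intros x; now rewrite sum_Sn.
      + eapply filterlim_comp_2; [exact IH|apply (Hlim (S N))|].
        apply (filterlim_plus (K := R_AbsRing) (V := R_NormedModule)). }
  assert (Hsum' := proj1 (filterlim_locally _ _) Hsum (mkposreal _ Heps)).
  generalize (filter_and _ _ Hphi Hsum'); apply filter_imp; intros x [H1 H2].
  assert (T1 := Htail (phi x) H1 N); assert (T2 := Htail l Hl N).
  unfold ball in H2 |- *; simpl in H2 |- *.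
  unfold AbsRing_ball, abs, minus, plus, opp in H2 |- *; simpl in H2 |- *.
  apply Rabs_le_between in T1; apply Rabs_le_between in T2.
  apply Rabs_lt_between in H2; apply Rabs_lt_between; lra.
Qed.

(** * Coefficients of the hypergeometric series *)

Definition hyp_coef (a b c : R) (n : nat) : R :=
  pochhammer a n * pochhammer b n / (pochhammer c n * INR (fact n)).

(** Coefficients of [(1 - z)^(-d)]. *)
Definition bin_coef (d : R) (n : nat) : R := pochhammer d n / INR (fact n).

Lemma hyp_coef_0 a b c : hyp_coef a b c 0 = 1.
Proof. unfold hyp_coef; simpl; field. Qed.

Lemma hyp_coef_pos a b c n : 0 < a -> 0 < b -> 0 < c -> 0 < hyp_coef a b c n.
Proof.
  intros Ha Hb Hc; unfold hyp_coef.
  assert (H1 := pochhammer_pos a n Ha); assert (H2 := pochhammer_pos b n Hb).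
  assert (H3 := pochhammer_pos c n Hc); assert (H4 := INR_fact_lt_0 n).
  apply Rdiv_lt_0_compat; nra.
Qed.

Lemma hyp_coef_S a b c n : 0 < c ->
  hyp_coef a b c (S n)
  = hyp_coef a b c n * ((a + INR n) * (b + INR n) / ((c + INR n) * INR (S n))).
Proof.
  intros Hc; unfold hyp_coef.
  assert (H3 := pochhammer_pos c n Hc); assert (H4 := INR_fact_lt_0 n).
  assert (H5 := pos_INR n); assert (H6 := INR_S_pos n).
  rewrite fact_simpl, mult_INR; simpl pochhammer.
  field; repeat split; lra.
Qed.

Lemma hyp_coef_shift a b c n : 0 < c ->
  hyp_coef a b (c + 1) n = hyp_coef a b c n * (c / (c + INR n)).
Proof.
  intros Hc; unfold hyp_coef.
  assert (Hc1 : 0 < c + 1) by lra.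
  assert (H2 := pochhammer_pos (c + 1) n Hc1).
  assert (H3 := pochhammer_pos c n Hc); assert (H4 := INR_fact_lt_0 n).
  assert (H5 := pos_INR n).
  assert (H := pochhammer_shift c n); simpl in H.
  replace (pochhammer (c + 1) n) with (pochhammer c n * (c + INR n) / c)
    by (rewrite H; field; lra).
  field; repeat split; lra.
Qed.

(** Gauss's contiguity relation between the parameters [c] and [c + 1]: term by
    term the two sides differ by the telescoping [n t_n - (n+1) t_(n+1)]. *)
Lemma gauss_contiguity a b c n : 0 < c ->
  (c - a - b) * sum_n (hyp_coef a b c) n
  = (c - a) * (c - b) / c * sum_n (hyp_coef a b (c + 1)) n
    - INR (S n) * hyp_coef a b c (S n).
Proof.
  intros Hc.
  assert (Hterm : forall k, (c - a - b) * hyp_coef a b c k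
    = (c - a) * (c - b) / c * hyp_coef a b (c + 1) k
      + (INR k * hyp_coef a b c k - INR (S k) * hyp_coef a b c (S k))).
  { intros k; rewrite (hyp_coef_S a b c k), (hyp_coef_shift a b c k) by exact Hc.
    assert (H5 := pos_INR k); assert (H6 := INR_S_pos k).
    field; repeat split; lra. }
  induction n as [|n IH].
  - rewrite !sum_O, Hterm; simpl; ring.
  - rewrite !sum_Sn; unfold plus; simpl AbelianMonoid.plus.
    unfold plus in *; simpl in IH |- *.
    rewrite !Rmult_plus_distr_l, IH, (Hterm (S n)); simpl; ring.
Qed.

Lemma bin_coef_hyp d n : bin_coef d n = hyp_coef d 1 1 n.
Proof.
  unfold bin_coef, hyp_coef.
  assert (H1 := pochhammer_pos 1 n Rlt_0_1); assert (H4 := INR_fact_lt_0 n).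
  field; split; lra.
Qed.

Lemma bin_coef_S d n : INR (S n) * bin_coef d (S n) = (d + INR n) * bin_coef d n.
Proof.
  rewrite !bin_coef_hyp, hyp_coef_S by lra.
  assert (H5 := pos_INR n); assert (H6 := INR_S_pos n).
  rewrite S_INR in *; field; lra.
Qed.

Lemma bin_coef_diff d n :
  bin_coef d n - bin_coef d (S n) = (1 - d) * (bin_coef d n / INR (S n)).
Proof.
  assert (H := bin_coef_S d n).
  assert (H5 := pos_INR n); assert (H6 := INR_S_pos n).
  apply Rmult_eq_reg_l with (INR (S n)); [|lra].
  rewrite Rmult_minus_distr_l, H, S_INR; field; rewrite <- S_INR; lra.
Qed.

Lemma bin_coef_bounds d n : 0 < d < 1 -> 0 < bin_coef d n <= 1.
Proof.
  intros Hd.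
  assert (Hpos : forall k, 0 < bin_coef d k).
  { intros k; apply Rdiv_lt_0_compat; [apply pochhammer_pos; lra|apply INR_fact_lt_0]. }
  split; [apply Hpos|].
  induction n as [|n IH].
  - unfold bin_coef; simpl; lra.
  - assert (H := bin_coef_diff d n); assert (H1 := Hpos n).
    assert (H2 := Rdiv_lt_0_compat _ _ H1 (INR_S_pos n)); nra.
Qed.

(** By Euler's limit [bin_coef d n] is asymptotic to [n^(d-1) / Gamma d]. *)
Lemma bin_coef_lim d : 0 < d < 1 -> is_lim_seq (bin_coef d) 0.
Proof.
  intros Hd.
  destruct (Gamma_correct d) as [HG [HG0 _]]; try lra.
  apply is_lim_seq_incr_1.
  apply (is_lim_seq_ext
    (fun n => Rpower (INR (S n)) (d - 1) / euler_gamma d (S n))).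
  - intros n; unfold euler_gamma, bin_coef.
    assert (H1 := pochhammer_pos d (S n) (proj1 Hd)).
    assert (H2 := INR_fact_lt_0 (S n)).
    assert (H3 : Rpower (INR (S n)) (d - 1) <> 0) by apply Rgt_not_eq, exp_pos.
    field; repeat split; lra.
  - apply is_lim_seq_incr_1 in HG.
    replace 0 with (0 / Gamma d) by (field; exact HG0).
    apply is_lim_seq_div'; [|exact HG|exact HG0].
    apply (is_lim_seq_incr_1 (fun n => Rpower (INR n) (d - 1))).
    unfold Rpower.
    apply (is_lim_comp_seq exp _ m_infty 0).
    + apply is_lim_exp_m.
    + exists O; intros n _; discriminate.
    + replace m_infty with (Rbar_mult (d - 1) p_infty).
      2: { simpl; case Rle_dec; intros; [exfalso; lra|reflexivity]. }
      apply is_lim_seq_scal_l.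
      apply (is_lim_comp_seq ln _ p_infty).
      * apply is_lim_ln_p.
      * exists O; intros n _; discriminate.
      * apply is_lim_seq_INR.
Qed.

Lemma ex_series_bin_coef d : 0 < d < 1 -> ex_series (fun n => bin_coef d n / INR (S n)).
Proof.
  intros Hd.
  apply (ex_series_ext (fun n => scal (/ (1 - d)) (bin_coef d n - bin_coef d (S n)))).
  - intros n; rewrite bin_coef_diff; unfold scal; simpl; unfold mult; simpl.
    assert (H6 := INR_S_pos n); simpl INR in H6; field; lra.
  - apply (ex_series_scal (K := R_AbsRing) (V := R_NormedModule)).
    eexists; apply is_series_telescope, bin_coef_lim, Hd.
Qed.

Lemma rGamma_pos x : 0 < x -> 0 < rGamma x.
Proof.
  intros Hx; unfold rGamma; destruct (Req_EM_T x 0) as [H|H]; [lra|].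
  apply Rinv_0_lt_compat, Gamma_correct; lra.
Qed.

(** The increments telescope; then the far end tends to the limit. *)
Lemma lim_rate (q : nat -> R) (K C : R) :
  is_lim_seq q K ->
  (forall n, Rabs (q (S n) - q n) <= C * (/ INR (S n) - / INR (S (S n)))) ->
  forall n, Rabs (q n - K) <= C / INR (S n).
Proof.
  intros Hq HC n.
  assert (H : forall m, Rabs (q (m + n)%nat - q n)
                        <= C * (/ INR (S n) - / INR (S (m + n)))).
  { induction m as [|m IH].
    - simpl plus; rewrite !Rminus_diag, Rabs_R0; lra.
    - assert (H := HC (m + n)%nat); change (S m + n)%nat with (S (m + n)).
      replace (q (S (m + n)) - q n)
        with ((q (S (m + n)) - q (m + n)%nat) + (q (m + n)%nat - q n)) by ring.
      eapply Rle_trans; [apply Rabs_triang|]. lra. }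
  assert (H1 : is_lim_seq (fun m => Rabs (q (m + n)%nat - q n)) (Rabs (K - q n))).
  { apply (is_lim_seq_abs _ (K - q n)), is_lim_seq_minus'; [|apply is_lim_seq_const].
    now apply is_lim_seq_incr_n. }
  assert (H2 : is_lim_seq (fun m => C * (/ INR (S n) - / INR (S (m + n))))
                          (C * (/ INR (S n) - 0))).
  { apply (is_lim_seq_scal_l _ C (/ INR (S n) - 0)).
    apply is_lim_seq_minus'; [apply is_lim_seq_const|].
    apply (is_lim_seq_incr_n (fun m => / INR (S m))), is_lim_seq_inv_S. }
  assert (H3 : Rabs (K - q n) <= C * (/ INR (S n) - 0))
    by exact (is_lim_seq_le _ _ _ _ H H1 H2).
  rewrite Rabs_minus_sym; unfold Rdiv; lra.
Qed.

(** The quotient [q] of the coefficients satisfies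
    [q (n+1) = q n (1 + (a b - c d) / ((c + n) (d + n)))], since [a + b = c + d]:
    its increments are [O(1/n^2)], and it is within [O(1/n)] of its limit [K]. *)
Lemma hyp_coef_asymptotics a b c d :
  0 < a -> 0 < b -> 0 < c -> 0 < d < 1 -> a + b = c + d ->
  exists K C : R, 0 < K /\
    forall n, Rabs (hyp_coef a b c n - K * bin_coef d n)
              <= C * (bin_coef d n / INR (S n)).
Proof.
  intros Ha Hb Hc Hd Hs.
  set (q := fun n => pochhammer a n * pochhammer b n
                     / (pochhammer c n * pochhammer d n)).
  assert (Hq : is_lim_seq q (Gamma c * Gamma d * (rGamma a * rGamma b)))
    by (apply pochhammer_quotient_lim; lra).
  set (K := Gamma c * Gamma d * (rGamma a * rGamma b)) in *.
  assert (HK : 0 < K).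
  { assert (H1 := rGamma_pos a Ha); assert (H2 := rGamma_pos b Hb).
    assert (H3 : 0 < Gamma c) by (apply Gamma_correct; lra).
    assert (H4 : 0 < Gamma d) by (apply Gamma_correct; lra).
    unfold K; apply Rmult_lt_0_compat; apply Rmult_lt_0_compat; assumption. }
  destruct (filterlim_bounded (K := R_AbsRing) (V := R_NormedModule) q (ex_intro _ K Hq))
    as [Q HQ].
  change norm with Rabs in HQ.
  set (m := Rmin 1 c * d).
  assert (Hm : 0 < m) by (unfold m, Rmin; destruct Rle_dec; nra).
  set (C := 2 * Q * Rabs (a * b - c * d) / m).
  assert (Hstep : forall n, Rabs (q (S n) - q n)
                            <= C * (/ INR (S n) - / INR (S (S n)))).
  { intros n.
    assert (Hn := pos_INR n).
    assert (H1 := pochhammer_pos c n Hc); assert (H2 := pochhammer_pos d n (proj1 Hd)).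
    replace (q (S n) - q n)
      with (q n * ((a * b - c * d) * / ((c + INR n) * (d + INR n)))).
    2: { unfold q; simpl pochhammer.
         replace a with (c + d - b) by lra.
         field; repeat split; lra. }
    rewrite !Rabs_mult, (Rabs_pos_eq (/ _)).
    2: left; apply Rinv_0_lt_compat; nra.
    assert (H3 : m * (INR (S n) * INR (S n)) <= (c + INR n) * (d + INR n)).
    { rewrite S_INR; unfold m.
      assert (Hr : Rmin 1 c * (INR n + 1) <= c + INR n)
        by (unfold Rmin; destruct Rle_dec; nra).
      assert (Hr0 : 0 < Rmin 1 c) by (unfold Rmin; destruct Rle_dec; lra).
      assert (Hr1 : d * (INR n + 1) <= d + INR n) by nra.
      replace (Rmin 1 c * d * ((INR n + 1) * (INR n + 1)))
        with (Rmin 1 c * (INR n + 1) * (d * (INR n + 1))) by ring.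
      apply Rmult_le_compat; nra. }
    assert (HS := INR_S_pos n).
    assert (H4 : / ((c + INR n) * (d + INR n)) <= / (m * (INR (S n) * INR (S n))))
      by (apply Rinv_le_contravar; [apply Rmult_lt_0_compat; [exact Hm|nra]|exact H3]).
    assert (H5 : / (INR (S n) * INR (S n)) <= 2 * (/ INR (S n) - / INR (S (S n))))
      by apply inv_sq_le_telescope.
    assert (HQ0 : 0 <= Q) by (eapply Rle_trans; [apply Rabs_pos|apply (HQ n)]).
    assert (Hab := Rabs_pos (a * b - c * d)).
    apply Rle_trans with
      (Q * (Rabs (a * b - c * d) * / (m * (INR (S n) * INR (S n))))).
    - apply Rmult_le_compat.
      + apply Rabs_pos.
      + apply Rmult_le_pos; [exact Hab|left; apply Rinv_0_lt_compat; nra].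
      + apply HQ.
      + apply Rmult_le_compat_l; assumption.
    - apply Rle_trans with
        (Q * Rabs (a * b - c * d) / m * (2 * (/ INR (S n) - / INR (S (S n))))).
      + rewrite Rinv_mult.
        replace (Q * (Rabs (a * b - c * d) * (/ m * / (INR (S n) * INR (S n)))))
          with (Q * Rabs (a * b - c * d) / m * / (INR (S n) * INR (S n)))
          by (unfold Rdiv; ring).
        apply Rmult_le_compat_l; [|exact H5].
        apply Rmult_le_pos; [nra|left; now apply Rinv_0_lt_compat].
      + right; unfold C, Rdiv; ring. }
  exists K, C; split; [exact HK|intros n].
  assert (Hr := lim_rate q K C Hq Hstep n).
  destruct (bin_coef_bounds d n Hd) as [Hb0 _].
  replace (hyp_coef a b c n - K * bin_coef d n) with (bin_coef d n * (q n - K)).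
  2: { unfold q, hyp_coef, bin_coef.
       assert (H1 := pochhammer_pos c n Hc); assert (H2 := pochhammer_pos d n (proj1 Hd)).
       assert (H3 := INR_fact_lt_0 n).
       field; repeat split; lra. }
  rewrite Rabs_mult, Rabs_pos_eq by lra.
  unfold Rdiv in *.
  replace (C * (bin_coef d n * / INR (S n))) with (bin_coef d n * (C * / INR (S n))) by ring.
  apply Rmult_le_compat_l; lra.
Qed.

(** * Regularised Gauss summation *)

Lemma hyp_coef_antimono a b c c' n :
  0 < a -> 0 < b -> 0 < c <= c' -> 0 < hyp_coef a b c' n <= hyp_coef a b c n.
Proof.
  intros Ha Hb [Hc Hcc]; split; [apply hyp_coef_pos; lra|].
  induction n as [|n IH]; [rewrite !hyp_coef_0; lra|].
  rewrite !hyp_coef_S by lra.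
  assert (Hn := pos_INR n); assert (HS := INR_S_pos n).
  assert (H0 : 0 <= (a + INR n) * (b + INR n)) by nra.
  apply Rmult_le_compat.
  - left; apply hyp_coef_pos; lra.
  - apply Rmult_le_pos; [exact H0|left; apply Rinv_0_lt_compat; nra].
  - exact IH.
  - apply Rmult_le_compat_l; [exact H0|].
    apply Rinv_le_contravar; nra.
Qed.

(** Gauss's relation makes the sum at [c + m] a multiple of the sum at [c + m + 1];
    the factors multiply to a quotient of Pochhammer symbols, and the sum at
    [c + m] tends to its first term [1]. *)
Lemma gauss_sum_limit a b c d :
  0 < a -> 0 < b -> 0 < c -> 0 < d < 1 -> a + b = c + d ->
  ex_series (hyp_coef a b (c + 1)) ->
  is_lim_seq (fun n => INR n * hyp_coef a b (c + 1) n) 0 ->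
  - ((c - a) * (c - b) / (c * d)) * Series (hyp_coef a b (c + 1))
  = Gamma c * Gamma (- d) * (rGamma (c - a) * rGamma (c - b)).
Proof.
  intros Ha Hb Hc Hd Hs Hex Hlim.
  set (s := fun m => Series (hyp_coef a b (c + 1 + INR m))).
  assert (Hdom : forall m n, 0 < hyp_coef a b (c + 1 + INR m) n <= hyp_coef a b (c + 1) n).
  { intros m n; assert (Hm := pos_INR m); apply hyp_coef_antimono; lra. }
  assert (Hexm : forall m, ex_series (hyp_coef a b (c + 1 + INR m))).
  { intros m; apply (ex_series_le (K := R_AbsRing) (V := R_CompleteNormedModule) _
                       (hyp_coef a b (c + 1))); [|exact Hex].
    intros n; change norm with Rabs; destruct (Hdom m n).
    rewrite Rabs_pos_eq; lra. }
  assert (Hs1 : is_lim_seq s 1).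
  { set (l := fun n => match n with O => 1 | S _ => 0 end).
    assert (Hl : Series l = 1).
    { rewrite (Series_incr_n l 1); [|lia|].
      - simpl; rewrite (Series_ext _ (fun n => 0 * 0)) by (intros; simpl; ring).
        rewrite Series_scal_l; ring.
      - apply (ex_series_incr_1 l); exists (0 - 0); simpl.
        apply (is_series_ext (fun n => 0 - 0)); [intros; simpl; ring|].
        apply (is_series_telescope (fun _ => 0)), is_lim_seq_const. }
    rewrite <- Hl.
    apply (filterlim_Series (F := eventually)
             (fun m => hyp_coef a b (c + 1 + INR m)) l (hyp_coef a b (c + 1)) Hex).
    - intros [|n]; simpl.
      + rewrite hyp_coef_0, Rabs_R1; lra.
      + rewrite Rabs_R0; left; apply hyp_coef_pos; lra.
    - exists O; intros m _ n; destruct (Hdom m n); rewrite Rabs_pos_eq; lra.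
    - intros [|n]; simpl.
      + apply filterlim_ext with (fun _ : nat => 1); [|apply filterlim_const].
        intros m; now rewrite hyp_coef_0.
      + change (is_lim_seq (fun m => hyp_coef a b (c + 1 + INR m) (S n)) 0).
        assert (Hn := pos_INR n); assert (HSn := INR_S_pos n).
        set (k := hyp_coef a b (c + 1) n * ((a + INR n) * (b + INR n) / INR (S n))).
        apply (is_lim_seq_le_le (fun _ => 0) _ (fun m => k * / INR (S m))).
        * intros m; destruct (Hdom m (S n)) as [H1 _]; split; [lra|].
          assert (Hm := pos_INR m).
          rewrite hyp_coef_S by lra; unfold k.
          replace ((a + INR n) * (b + INR n) / ((c + 1 + INR m + INR n) * INR (S n)))
            with ((a + INR n) * (b + INR n) / INR (S n) * / (c + 1 + INR m + INR n))
            by (field; lra).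
          assert (H0 : 0 <= (a + INR n) * (b + INR n) / INR (S n)).
          { apply Rmult_le_pos; [nra|left; now apply Rinv_0_lt_compat]. }
          destruct (Hdom m n) as [H2 H3].
          rewrite <- Rmult_assoc; apply Rmult_le_compat.
          -- apply Rmult_le_pos; lra.
          -- left; apply Rinv_0_lt_compat; lra.
          -- apply Rmult_le_compat_r; lra.
          -- rewrite S_INR; apply Rinv_le_contravar; lra.
        * apply is_lim_seq_const.
        * replace 0 with (k * 0) by ring.
          apply (is_lim_seq_scal_l _ k 0), is_lim_seq_inv_S. }
  assert (Hrec : forall m, (1 - d + INR m) * s m
    = (c + 1 + INR m - a) * (c + 1 + INR m - b) / (c + 1 + INR m) * s (S m)).
  { intros m; assert (Hm := pos_INR m).
    assert (HcS : c + 1 + INR (S m) = c + 1 + INR m + 1) by (rewrite S_INR; ring).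
    assert (L1 : is_lim_seq
      (fun n => (c + 1 + INR m - a - b) * sum_n (hyp_coef a b (c + 1 + INR m)) n)
      ((c + 1 + INR m - a - b) * s m)).
    { apply (is_lim_seq_scal_l _ _ (s m)), Series_correct, Hexm. }
    assert (L2 : is_lim_seq
      (fun n => (c + 1 + INR m - a) * (c + 1 + INR m - b) / (c + 1 + INR m)
                * sum_n (hyp_coef a b (c + 1 + INR m + 1)) n
                - INR (S n) * hyp_coef a b (c + 1 + INR m) (S n))
      ((c + 1 + INR m - a) * (c + 1 + INR m - b) / (c + 1 + INR m) * s (S m) - 0)).
    { apply is_lim_seq_minus'.
      - apply (is_lim_seq_scal_l _ _ (s (S m))).
        rewrite <- HcS; apply Series_correct, Hexm.
      - apply (is_lim_seq_incr_1 (fun n => INR n * hyp_coef a b (c + 1 + INR m) n)).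
        apply (is_lim_seq_le_le (fun _ => 0) _ (fun n => INR n * hyp_coef a b (c + 1) n)).
        + intros n; destruct (Hdom m n); assert (Hn := pos_INR n); nra.
        + apply is_lim_seq_const.
        + exact Hlim. }
    assert (L3 := is_lim_seq_unique _ _ L1).
    rewrite (Lim_seq_ext _ _ (fun n => gauss_contiguity a b (c + 1 + INR m) n ltac:(lra))),
      (is_lim_seq_unique _ _ L2) in L3.
    injection L3; intros L4.
    replace (1 - d + INR m) with (c + 1 + INR m - a - b) by lra.
    lra. }
  (* The product of the first [m] factors of the recurrence, started at [c]. *)
  set (Q := fun m => pochhammer (c - a) m * pochhammer (c - b) m
                     / (pochhammer c m * pochhammer (- d) m)).
  assert (HQ : forall m, Q (S m) * s m
    = - ((c - a) * (c - b) / (c * d)) * Series (hyp_coef a b (c + 1))).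
  { induction m as [|m IH].
    - unfold Q, s; simpl.
      rewrite (Series_ext (hyp_coef a b (c + 1 + 0)) (hyp_coef a b (c + 1)))
        by (intros; f_equal; ring).
      field; lra.
    - rewrite <- IH.
      assert (Hm := pos_INR m).
      assert (H1 := pochhammer_pos c (S m) Hc).
      assert (H2 : pochhammer (- d) (S m) <> 0) by (apply pochhammer_neq_0; lra).
      replace (s m) with ((c + 1 + INR m - a) * (c + 1 + INR m - b)
                          / ((c + 1 + INR m) * (1 - d + INR m)) * s (S m)).
      + unfold Q.
        change (pochhammer (c - a) (S (S m)))
          with (pochhammer (c - a) (S m) * (c - a + INR (S m))).
        change (pochhammer (c - b) (S (S m)))
          with (pochhammer (c - b) (S m) * (c - b + INR (S m))).
        change (pochhammer c (S (S m))) with (pochhammer c (S m) * (c + INR (S m))).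
        change (pochhammer (- d) (S (S m)))
          with (pochhammer (- d) (S m) * (- d + INR (S m))).
        rewrite S_INR; field; repeat split; lra.
      + apply Rmult_eq_reg_l with (1 - d + INR m); [|lra].
        rewrite Hrec; field; lra. }
  assert (LQ : is_lim_seq (fun m => Q (S m) * s m)
                 (Gamma c * Gamma (- d) * (rGamma (c - a) * rGamma (c - b)) * 1)).
  { apply is_lim_seq_mult'; [|exact Hs1].
    apply (is_lim_seq_incr_1 Q), pochhammer_quotient_lim; lra. }
  apply (is_lim_seq_ext _ _ _ HQ) in LQ.
  apply is_lim_seq_unique in LQ; rewrite Lim_seq_const in LQ.
  injection LQ; lra.
Qed.

(** Summability follows from that of [bin_coef d n / (n + 1)].  Gauss's relation,
    applied to both sequences, evaluates the sum: each boundary term grows like [n^d],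
    but in the difference they cancel up to [o(1)]. *)
Lemma hyp_coef_remainder a b c d :
  0 < a -> 0 < b -> 0 < c -> 0 < d < 1 -> a + b = c + d ->
  exists K : R, 0 < K /\
    let g := fun n => hyp_coef a b c n - K * bin_coef d n in
    ex_series (fun n => Rabs (g n)) /\
    Series g = Gamma c * Gamma (- d) * (rGamma (c - a) * rGamma (c - b)).
Proof.
  intros Ha Hb Hc Hd Hs.
  destruct (hyp_coef_asymptotics a b c d Ha Hb Hc Hd Hs) as [K [C [HK HC]]].
  exists K; split; [exact HK|intros g].
  assert (HC0 : 0 <= C).
  { assert (H := Rle_trans _ _ _ (Rabs_pos _) (HC O)).
    unfold bin_coef in H; simpl in H; lra. }
  assert (Hg : ex_series (fun n => Rabs (g n))).
  { apply (ex_series_le (K := R_AbsRing) (V := R_CompleteNormedModule) _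
             (fun n => scal C (bin_coef d n / INR (S n)))).
    - intros n; change norm with Rabs; rewrite Rabs_Rabsolu; apply HC.
    - apply (ex_series_scal (K := R_AbsRing) (V := R_NormedModule)).
      now apply ex_series_bin_coef. }
  split; [exact Hg|].
  assert (Hle : forall n, hyp_coef a b c n <= (K + C) * bin_coef d n).
  { intros n; assert (H := HC n).
    destruct (bin_coef_bounds d n Hd) as [Hb0 _].
    apply Rabs_le_between in H.
    assert (H1 : bin_coef d n / INR (S n) <= bin_coef d n).
    { apply Rle_div_l; [apply INR_S_pos|].
      rewrite S_INR; assert (Hn := pos_INR n); nra. }
    nra. }
  set (M := (K + C) * Rmax 1 c).
  assert (Hle1 : forall n, hyp_coef a b (c + 1) n <= M * (bin_coef d n / INR (S n))).
  { intros n; rewrite hyp_coef_shift by exact Hc.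
    assert (Hn := pos_INR n); destruct (bin_coef_bounds d n Hd) as [Hb0 _].
    assert (Hc1 : c / (c + INR n) <= Rmax 1 c / INR (S n)).
    { rewrite S_INR; apply Rmult_le_reg_r with ((c + INR n) * (INR n + 1)); [nra|].
      replace (c / (c + INR n) * ((c + INR n) * (INR n + 1)))
        with (c * (INR n + 1)) by (field; lra).
      replace (Rmax 1 c / (INR n + 1) * ((c + INR n) * (INR n + 1)))
        with (Rmax 1 c * (c + INR n)) by (field; lra).
      unfold Rmax; destruct Rle_dec; nra. }
    unfold M.
    replace ((K + C) * Rmax 1 c * (bin_coef d n / INR (S n)))
      with ((K + C) * bin_coef d n * (Rmax 1 c / INR (S n)))
      by (unfold Rdiv; ring).
    apply Rmult_le_compat; [left; now apply hyp_coef_pos| |apply Hle|exact Hc1].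
    left; apply Rdiv_lt_0_compat; lra. }
  assert (Hex1 : ex_series (hyp_coef a b (c + 1))).
  { apply (ex_series_le (K := R_AbsRing) (V := R_CompleteNormedModule) _
             (fun n => scal M (bin_coef d n / INR (S n)))).
    - intros n; change norm with Rabs; rewrite Rabs_pos_eq; [apply Hle1|].
      left; apply hyp_coef_pos; lra.
    - apply (ex_series_scal (K := R_AbsRing) (V := R_NormedModule)).
      now apply ex_series_bin_coef. }
  (* Disposes of the boundary terms of Gauss's relation. *)
  assert (Hsqueeze : forall (M' : R) (u : nat -> R),
    (forall n, Rabs (u n) <= M' * bin_coef d n) -> is_lim_seq u 0).
  { intros M' u Hu.
    apply is_lim_seq_abs_0.
    apply (is_lim_seq_le_le (fun _ => 0) _ (fun n => M' * bin_coef d n)).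
    - intros n; split; [apply Rabs_pos|apply Hu].
    - apply is_lim_seq_const.
    - replace 0 with (M' * 0) by ring.
      now apply (is_lim_seq_scal_l _ M' 0), bin_coef_lim. }
  assert (Hlim1 : is_lim_seq (fun n => INR n * hyp_coef a b (c + 1) n) 0).
  { apply (Hsqueeze M); intros n.
    assert (Hn := pos_INR n); assert (H := Hle1 n).
    assert (H0 : 0 < hyp_coef a b (c + 1) n) by (apply hyp_coef_pos; lra).
    destruct (bin_coef_bounds d n Hd) as [Hb0 _].
    rewrite Rabs_pos_eq by nra.
    assert (HS := INR_S_pos n).
    apply Rle_trans with (INR (S n) * (M * (bin_coef d n / INR (S n)))).
    - apply Rmult_le_compat; try lra; rewrite S_INR; lra.
    - right; field; lra. }
  rewrite <- (gauss_sum_limit a b c d) by assumption.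
  assert (L1 : is_lim_seq (fun n => - d * sum_n g n) (- d * Series g)).
  { apply (is_lim_seq_scal_l _ _ (Series g)), Series_correct.
    now apply ex_series_Rabs. }
  assert (L2 : is_lim_seq
    (fun n => (c - a) * (c - b) / c * sum_n (hyp_coef a b (c + 1)) n
              - INR (S n) * g (S n))
    ((c - a) * (c - b) / c * Series (hyp_coef a b (c + 1)) - 0)).
  { apply is_lim_seq_minus'.
    - apply (is_lim_seq_scal_l _ _ (Series (hyp_coef a b (c + 1)))).
      now apply Series_correct.
    - apply (is_lim_seq_incr_1 (fun n => INR n * g n)), (Hsqueeze C); intros n.
      assert (Hn := pos_INR n); assert (HS := INR_S_pos n).
      rewrite Rabs_mult, Rabs_pos_eq by exact Hn.
      apply Rle_trans with (INR (S n) * (C * (bin_coef d n / INR (S n)))).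
      + apply Rmult_le_compat; try lra.
        * apply Rabs_pos.
        * rewrite S_INR; lra.
        * apply HC.
      + right; field; lra. }
  assert (Heq : forall n, - d * sum_n g n
    = (c - a) * (c - b) / c * sum_n (hyp_coef a b (c + 1)) n - INR (S n) * g (S n)).
  { intros n.
    assert (Hsum : sum_n g n = sum_n (hyp_coef a b c) n - K * sum_n (bin_coef d) n).
    { clear; induction n as [|n IH].
      - rewrite !sum_O; reflexivity.
      - rewrite !sum_Sn, IH; unfold plus; simpl; unfold g; ring. }
    (* With c = b = 1 the contiguity relation sums the binomial coefficients. *)
    assert (Hbin : d * sum_n (bin_coef d) n = INR (S n) * bin_coef d (S n)).
    { assert (H := gauss_contiguity d 1 1 n Rlt_0_1).
      assert (E : sum_n (bin_coef d) n = sum_n (hyp_coef d 1 1) n)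
        by apply sum_n_ext, bin_coef_hyp.
      rewrite E, bin_coef_hyp.
      transitivity (- ((1 - d - 1) * sum_n (hyp_coef d 1 1) n)); [ring|].
      rewrite H; field. }
    assert (H := gauss_contiguity a b c n Hc).
    replace (c - a - b) with (- d) in H by lra.
    rewrite Hsum; unfold g.
    transitivity (- d * sum_n (hyp_coef a b c) n + K * (d * sum_n (bin_coef d) n)); [ring|].
    rewrite H, Hbin; ring. }
  assert (L3 := is_lim_seq_unique _ _ L1).
  rewrite (Lim_seq_ext _ _ Heq), (is_lim_seq_unique _ _ L2) in L3.
  injection L3; intros L4.
  apply Rmult_eq_reg_l with (- d); [|lra].
  rewrite <- L4; field; lra.
Qed.

(** * The binomial series in the complex disk *)

(** The principal power, given by the polar coordinates of the right half-plane. *)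
Definition cpower (w : C) (s : R) : C :=
  Cmult (RtoC (exp (s * ln (Cmod w)))) (cis (s * atan (Im w / Re w))).

(** Real and imaginary parts are summed separately, so that results on real series
    apply to each of them. *)
Definition csum (a : nat -> R) (z : C) : C :=
  (Series (fun n => a n * Re (Cpow z n)), Series (fun n => a n * Im (Cpow z n))).

Lemma Re_Cpow_S z n : Re (Cpow z (S n)) = Re z * Re (Cpow z n) - Im z * Im (Cpow z n).
Proof. reflexivity. Qed.

Lemma Im_Cpow_S z n : Im (Cpow z (S n)) = Re z * Im (Cpow z n) + Im z * Re (Cpow z n).
Proof. reflexivity. Qed.

Lemma Re_le_Cmod z : Rabs (Re z) <= Cmod z.
Proof. apply re_le_Cmod. Qed.

Lemma Im_le_Cmod z : Rabs (Im z) <= Cmod z.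
Proof. eapply Rle_trans; [apply Rmax_r|apply (Rmax_Cmod z)]. Qed.

(** Along a radius [t z] both sides of the binomial theorem satisfy the linear
    equation [(1 - t z) S' = d z S]; so [S (1 - t z)^d] is constant. *)
Lemma binomial_series d z : 0 < d < 1 -> Cmod z < 1 ->
  csum (bin_coef d) z = cpower (Cminus (RtoC 1) z) (- d).
Proof.
  intros Hd Hz.
  set (x := Re z); set (y := Im z).
  set (a := fun n => bin_coef d n * Re (Cpow z n)).
  set (b := fun n => bin_coef d n * Im (Cpow z n)).
  assert (Hm0 := Cmod_ge_0 z).
  (* A radius of convergence larger than 1, so that [t = 1] is an interior point. *)
  set (r := 2 / (1 + Cmod z)).
  assert (Hr1 : 1 < r) by (unfold r; apply Rlt_div_r; lra).
  assert (Hrz : 0 <= Cmod z * r <= 1).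
  { split; [nra|].
    unfold r, Rdiv; rewrite <- Rmult_assoc; apply Rle_div_l; lra. }
  assert (Hcv : forall (p : C -> R), (forall w, Rabs (p w) <= Cmod w) ->
    Rbar_le r (CV_radius (fun n => bin_coef d n * p (Cpow z n)))).
  { intros p Hp.
    apply (proj1 (CV_radius_bounded (fun n => bin_coef d n * p (Cpow z n)))).
    exists 1; intros n.
    destruct (bin_coef_bounds d n Hd) as [Hb0 Hb1].
    rewrite !Rabs_mult, Rabs_pos_eq, <- RPow_abs, (Rabs_pos_eq r) by lra.
    assert (Hp1 := Hp (Cpow z n)); rewrite Cmod_pow in Hp1.
    assert (Hrn : 0 < r ^ n) by (apply pow_lt; lra).
    assert (Hzr : (Cmod z * r) ^ n <= 1)
      by (rewrite <- (pow1 n); apply pow_incr; lra).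
    rewrite Rpow_mult_distr in Hzr.
    assert (Hpp := Rabs_pos (p (Cpow z n))).
    apply Rle_trans with (1 * Cmod z ^ n * r ^ n); [|lra].
    apply Rmult_le_compat_r; [lra|]; apply Rmult_le_compat; lra. }
  assert (Hcva : Rbar_le r (CV_radius a)) by (apply (Hcv Re), Re_le_Cmod).
  assert (Hcvb : Rbar_le r (CV_radius b)) by (apply (Hcv Im), Im_le_Cmod).
  assert (Hin : forall t, 0 <= t <= 1 ->
    Rbar_lt (Rabs t) (CV_radius a) /\ Rbar_lt (Rabs t) (CV_radius b)).
  { intros t Ht; rewrite Rabs_pos_eq by lra.
    split; eapply Rbar_lt_le_trans; try eassumption; simpl; lra. }
  set (U := PSeries a); set (V := PSeries b).
  set (U' := PSeries (PS_derive a)); set (V' := PSeries (PS_derive b)).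
  set (rho := fun t => (1 - t * x) ^ 2 + (t * y) ^ 2).
  set (th := fun t => atan (- (t * y) / (1 - t * x))).
  assert (Hx1 : forall t, 0 <= t <= 1 -> 0 < 1 - t * x).
  { intros t Ht; assert (H := Re_le_Cmod z); fold x in H.
    apply Rabs_le_between in H; nra. }
  assert (Hrho : forall t, 0 <= t <= 1 -> 0 < rho t).
  { intros t Ht; unfold rho; assert (H := Hx1 t Ht).
    assert (H1 := pow2_ge_0 (t * y)); assert (0 < (1 - t * x) ^ 2) by nra; lra. }
  assert (Hode : forall t, 0 <= t <= 1 ->
    U' t = d * (x * U t - y * V t) + t * (x * U' t - y * V' t) /\
    V' t = d * (x * V t + y * U t) + t * (x * V' t + y * U' t)).
  { intros t Ht; destruct (Hin t Ht) as [Ha Hb].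
    assert (Ea := CV_radius_inside _ _ Ha); assert (Eb := CV_radius_inside _ _ Hb).
    assert (Ea' : ex_pseries (PS_derive a) t)
      by (apply CV_radius_inside; now rewrite CV_radius_derive).
    assert (Eb' : ex_pseries (PS_derive b) t)
      by (apply CV_radius_inside; now rewrite CV_radius_derive).
    assert (Hcomb : forall p q : R,
      PSeries (PS_plus (PS_plus (PS_scal (d * p) a) (PS_scal (d * q) b))
                 (PS_plus (PS_scal p (PS_incr_1 (PS_derive a)))
                          (PS_scal q (PS_incr_1 (PS_derive b))))) t
      = d * (p * U t + q * V t) + t * (p * U' t + q * V' t)).
    { intros p q.
      assert (Hc : forall c : R, mult t c = mult c t) by (intros; apply Rmult_comm).
      assert (Eab : forall e : nat -> R, ex_pseries e t ->
        forall c, ex_pseries (PS_scal c e) t)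
        by (intros e He c; now apply ex_pseries_scal).
      assert (Ei := ex_pseries_incr_1 _ _ Ea'); assert (Ei' := ex_pseries_incr_1 _ _ Eb').
      rewrite PSeries_plus by (apply ex_pseries_plus; now apply Eab).
      rewrite (PSeries_plus (PS_scal _ a)), (PSeries_plus (PS_scal p _))
        by now apply Eab.
      rewrite !PSeries_scal, !PSeries_incr_1.
      unfold U, V, U', V'; ring. }
    assert (Hincr : forall (e : nat -> R) n,
      PS_incr_1 (PS_derive e) n = INR n * e n :> R).
    { intros e [|n]; [simpl; unfold zero; simpl; ring|reflexivity]. }
    split.
    - replace (x * U t - y * V t) with (x * U t + - y * V t) by ring.
      replace (x * U' t - y * V' t) with (x * U' t + - y * V' t) by ring.
      rewrite <- Hcomb; apply PSeries_ext; intros n.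
      unfold PS_plus, PS_scal, plus, scal; simpl; unfold mult; simpl.
      rewrite !Hincr; unfold PS_derive, a, b.
      rewrite <- Rmult_assoc, bin_coef_S, Re_Cpow_S; fold x y; ring.
    - rewrite (Rplus_comm (x * V t)), (Rplus_comm (x * V' t)).
      rewrite <- Hcomb; apply PSeries_ext; intros n.
      unfold PS_plus, PS_scal, plus, scal; simpl; unfold mult; simpl.
      rewrite !Hincr; unfold PS_derive, a, b.
      rewrite <- Rmult_assoc, bin_coef_S, Im_Cpow_S; fold x y; ring. }
  set (L := fun t => ln (rho t) / 2).
  assert (HL : forall t, 0 <= t <= 1 -> is_derive L t ((- x * (1 - t * x) + t * y * y) / rho t)).
  { intros t Ht; assert (H := Hrho t Ht); unfold L, rho in *.
    auto_derive; [lra|field; lra]. }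
  assert (HT : forall t, 0 <= t <= 1 -> is_derive th t (- y / rho t)).
  { intros t Ht; assert (H := Hrho t Ht); assert (H1 := Hx1 t Ht).
    replace (- y / rho t) with (- y / (1 - t * x) ^ 2
                                * / (1 + Rsqr (- (t * y) / (1 - t * x)))).
    - apply (is_derive_comp atan (fun t => - (t * y) / (1 - t * x))).
      + apply is_derive_atan.
      + auto_derive; [lra|field; lra].
    - unfold rho, Rsqr in *; field; repeat split; lra. }
  assert (HU : forall t, 0 <= t <= 1 -> is_derive U t
    (d * (- ((- x * (1 - t * x) + t * y * y) / rho t) * U t + - y / rho t * V t))
    /\ is_derive V t
    (d * (- ((- x * (1 - t * x) + t * y * y) / rho t) * V t - - y / rho t * U t))).
  { intros t Ht; destruct (Hin t Ht) as [Ha Hb]; destruct (Hode t Ht) as [H1 H2].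
    assert (H := Hrho t Ht).
    assert (DU := is_derive_PSeries a t Ha); assert (DV := is_derive_PSeries b t Hb).
    fold U U' in DU; fold V V' in DV.
    (* Cramer's rule for the two real equations, of determinant [rho t]. *)
    assert (E1 : rho t * U' t
      = d * (- (- x * (1 - t * x) + t * y * y) * U t + - y * V t)).
    { unfold rho.
      transitivity ((1 - t * x) * (U' t - t * (x * U' t - y * V' t))
                    - t * y * (V' t - t * (x * V' t + y * U' t))); [ring|].
      replace (U' t - t * (x * U' t - y * V' t)) with (d * (x * U t - y * V t)) by lra.
      replace (V' t - t * (x * V' t + y * U' t)) with (d * (x * V t + y * U t)) by lra.
      ring. }
    assert (E2 : rho t * V' t
      = d * (- (- x * (1 - t * x) + t * y * y) * V t - - y * U t)).
    { unfold rho.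
      transitivity ((1 - t * x) * (V' t - t * (x * V' t + y * U' t))
                    + t * y * (U' t - t * (x * U' t - y * V' t))); [ring|].
      replace (U' t - t * (x * U' t - y * V' t)) with (d * (x * U t - y * V t)) by lra.
      replace (V' t - t * (x * V' t + y * U' t)) with (d * (x * V t + y * U t)) by lra.
      ring. }
    split.
    - replace (d * _) with (U' t); [exact DU|].
      apply Rmult_eq_reg_l with (rho t); [rewrite E1; field; lra|lra].
    - replace (d * _) with (V' t); [exact DV|].
      apply Rmult_eq_reg_l with (rho t); [rewrite E2; field; lra|lra]. }
  (* The real and imaginary parts of [S (1 - t z)^d]. *)
  set (Q1 := fun t => exp (d * L t)
                      * (U t * cos (d * th t) - V t * sin (d * th t))).
  set (Q2 := fun t => exp (d * L t)
                      * (U t * sin (d * th t) + V t * cos (d * th t))).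
  assert (HQ : Q1 0 = Q1 1 /\ Q2 0 = Q2 1).
  { assert (Hex : forall t, 0 <= t <= 1 ->
      ex_derive L t /\ ex_derive th t /\ ex_derive U t /\ ex_derive V t).
    { intros t Ht; destruct (HU t Ht).
      repeat split; eexists; [apply HL|apply HT| |]; eassumption. }
    split; apply eq_is_derive; try lra; intros t Ht.
    - destruct (Hex t Ht) as [X1 [X2 [X3 X4]]]; destruct (HU t Ht) as [Y1 Y2].
      change Q1 with (fun t => exp (d * L t) * (U t * cos (d * th t) - V t * sin (d * th t))).
      auto_derive; [repeat split; assumption|].
      change (fun x : R => L x) with L; change (fun x : R => U x) with U.
      change (fun x : R => V x) with V; change (fun x : R => th x) with th.
      rewrite (is_derive_unique _ _ _ (HL t Ht)), (is_derive_unique _ _ _ (HT t Ht)),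
        (is_derive_unique _ _ _ Y1), (is_derive_unique _ _ _ Y2).
      unfold zero; simpl; ring.
    - destruct (Hex t Ht) as [X1 [X2 [X3 X4]]]; destruct (HU t Ht) as [Y1 Y2].
      change Q2 with (fun t => exp (d * L t) * (U t * sin (d * th t) + V t * cos (d * th t))).
      auto_derive; [repeat split; assumption|].
      change (fun x : R => L x) with L; change (fun x : R => U x) with U.
      change (fun x : R => V x) with V; change (fun x : R => th x) with th.
      rewrite (is_derive_unique _ _ _ (HL t Ht)), (is_derive_unique _ _ _ (HT t Ht)),
        (is_derive_unique _ _ _ Y1), (is_derive_unique _ _ _ Y2).
      unfold zero; simpl; ring. }
  assert (H0 : Q1 0 = 1 /\ Q2 0 = 0).
  { unfold Q1, Q2, L, rho, th, U, V; rewrite !PSeries_0.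
    replace ((1 - 0 * x) ^ 2 + (0 * y) ^ 2) with 1 by ring.
    replace (- (0 * y) / (1 - 0 * x)) with 0 by (field; lra).
    rewrite ln_1, atan_0, !Rmult_0_r, sin_0, cos_0.
    replace (d * (0 / 2)) with 0 by field; rewrite exp_0.
    unfold a, b, bin_coef; simpl; split; field. }
  destruct HQ as [HQ1 HQ2]; destruct H0 as [H01 H02].
  rewrite H01 in HQ1; rewrite H02 in HQ2; clear H01 H02.
  unfold Q1, L in HQ1; unfold Q2, L in HQ2.
  assert (HS : csum (bin_coef d) z = (U 1, V 1)).
  { unfold csum, U, V, PSeries; f_equal; apply Series_ext; intros n;
      rewrite pow1, Rmult_1_r; reflexivity. }
  rewrite HS; unfold cpower.
  replace (Im (Cminus (RtoC 1) z) / Re (Cminus (RtoC 1) z))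
    with (- (1 * y) / (1 - 1 * x)).
  2: { unfold x, y, Cminus, Cplus, Copp, Re, Im, RtoC; simpl; f_equal; ring. }
  change (atan (- (1 * y) / (1 - 1 * x))) with (th 1).
  assert (Hln : ln (Cmod (Cminus (RtoC 1) z)) = ln (rho 1) / 2).
  { assert (H : rho 1 = Cmod (Cminus (RtoC 1) z) ^ 2).
    { rewrite Cmod2_alt; unfold rho, x, y, Cminus, Cplus, Copp, Re, Im, RtoC; simpl; ring. }
    assert (Hp := Hrho 1 ltac:(lra)).
    assert (Hc := Cmod_ge_0 (Cminus (RtoC 1) z)).
    rewrite H in *; simpl; rewrite Rmult_1_r, ln_mult by nra; field. }
  rewrite Hln.
  replace (- d * (ln (rho 1) / 2)) with (- (d * (ln (rho 1) / 2))) by ring.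
  unfold cis; rewrite exp_Ropp, Ropp_mult_distr_l_reverse, cos_neg, sin_neg.
  set (E := exp (d * (ln (rho 1) / 2))) in *.
  assert (HE : 0 < E) by apply exp_pos.
  assert (Hsc := sin2_cos2 (d * th 1)); unfold Rsqr in Hsc.
  set (co := cos (d * th 1)) in *; set (si := sin (d * th 1)) in *.
  unfold Cmult; simpl.
  f_equal; apply Rmult_eq_reg_l with E; try lra.
  - transitivity ((co * (E * (U 1 * co - V 1 * si)) + si * (E * (U 1 * si + V 1 * co)))
                  * (si * si + co * co)).
    + transitivity (E * U 1 * (si * si + co * co) * (si * si + co * co)); [|ring].
      rewrite Hsc; ring.
    + rewrite <- HQ1, <- HQ2, Hsc; field; lra.
  - transitivity ((co * (E * (U 1 * si + V 1 * co)) - si * (E * (U 1 * co - V 1 * si)))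
                  * (si * si + co * co)).
    + transitivity (E * V 1 * (si * si + co * co) * (si * si + co * co)); [|ring].
      rewrite Hsc; ring.
    + rewrite <- HQ1, <- HQ2, Hsc; field; lra.
Qed.

(** * Limits of complex-valued functions *)

Lemma locally_Cmod (z : C) (P : C -> Prop) :
  locally (T := C_UniformSpace) z P
  <-> exists eps, 0 < eps /\ forall w, Cmod (Cminus w z) < eps -> P w.
Proof.
  rewrite locally_C; split.
  - intros [eps H]; exists eps; split; [apply cond_pos|]; intros w Hw; apply H, Hw.
  - intros [eps [He H]]; exists (mkposreal eps He); intros w Hw; apply H, Hw.
Qed.

Section Filterlim_C.

Context {T : Type} {F : (T -> Prop) -> Prop} {FF : Filter F}.

Lemma filterlim_C (f : T -> C) (l : C) :
  filterlim (fun x => Re (f x)) F (locally (Re l)) ->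
  filterlim (fun x => Im (f x)) F (locally (Im l)) ->
  filterlim f F (locally (T := C_UniformSpace) l).
Proof.
  intros H1 H2; apply filterlim_locally; intros eps.
  generalize (filter_and _ _ (proj1 (filterlim_locally _ _) H1 eps)
                (proj1 (filterlim_locally _ _) H2 eps)).
  apply filter_imp; intros x [G1 G2]; split; assumption.
Qed.

Lemma filterlim_Re_Im (f : T -> C) (l : C) :
  filterlim f F (locally (T := C_UniformSpace) l) ->
  filterlim (fun x => Re (f x)) F (locally (Re l)) /\
  filterlim (fun x => Im (f x)) F (locally (Im l)).
Proof.
  intros H; split; apply filterlim_locally; intros eps;
    generalize (proj1 (filterlim_locally (U := C_UniformSpace) f l) H eps);
    apply filter_imp; intros x [G1 G2]; assumption.
Qed.

Lemma filterlim_Rplus (f g : T -> R) (a b : R) :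
  filterlim f F (locally a) -> filterlim g F (locally b) ->
  filterlim (fun x => f x + g x) F (locally (a + b)).
Proof.
  intros H1 H2; eapply filterlim_comp_2; [exact H1|exact H2|].
  apply (filterlim_plus (K := R_AbsRing) (V := R_NormedModule)).
Qed.

Lemma filterlim_Rmult (f g : T -> R) (a b : R) :
  filterlim f F (locally a) -> filterlim g F (locally b) ->
  filterlim (fun x => f x * g x) F (locally (a * b)).
Proof.
  intros H1 H2; eapply filterlim_comp_2; [exact H1|exact H2|].
  apply (filterlim_mult (K := R_AbsRing)).
Qed.

Lemma filterlim_Rcomp (h : R -> R) (f : T -> R) (a : R) :
  filterlim f F (locally a) -> ex_derive h a ->
  filterlim (fun x => h (f x)) F (locally (h a)).
Proof.
  intros H1 H2; eapply filterlim_comp; [exact H1|].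
  exact (ex_derive_continuous h a H2).
Qed.

Lemma filterlim_Ropp (f : T -> R) (a : R) :
  filterlim f F (locally a) -> filterlim (fun x => - f x) F (locally (- a)).
Proof. intros H; apply (filterlim_Rcomp Ropp); [exact H|]; auto_derive; exact I. Qed.

Lemma filterlim_Cplus (f g : T -> C) (a b : C) :
  filterlim f F (locally (T := C_UniformSpace) a) ->
  filterlim g F (locally (T := C_UniformSpace) b) ->
  filterlim (fun x => Cplus (f x) (g x)) F (locally (T := C_UniformSpace) (Cplus a b)).
Proof.
  intros H1 H2; apply filterlim_Re_Im in H1; apply filterlim_Re_Im in H2.
  apply filterlim_C; apply filterlim_Rplus; tauto.
Qed.

Lemma filterlim_Cmult (f g : T -> C) (a b : C) :
  filterlim f F (locally (T := C_UniformSpace) a) ->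
  filterlim g F (locally (T := C_UniformSpace) b) ->
  filterlim (fun x => Cmult (f x) (g x)) F (locally (T := C_UniformSpace) (Cmult a b)).
Proof.
  intros H1 H2; apply filterlim_Re_Im in H1; apply filterlim_Re_Im in H2.
  apply filterlim_C; apply filterlim_Rplus; try apply filterlim_Ropp;
    apply filterlim_Rmult; tauto.
Qed.

Lemma filterlim_cpower (s : R) (f : T -> C) (w : C) :
  0 < Re w -> filterlim f F (locally (T := C_UniformSpace) w) ->
  filterlim (fun x => cpower (f x) s) F (locally (T := C_UniformSpace) (cpower w s)).
Proof.
  intros Hw H; apply filterlim_Re_Im in H; destruct H as [H1 H2].
  assert (Hpos : 0 < Re w ^ 2 + Im w ^ 2).
  { assert (H := pow2_ge_0 (Im w)); nra. }
  assert (Hmod : filterlim (fun x => exp (s * ln (Cmod (f x)))) F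
                   (locally (exp (s * ln (Cmod w))))).
  { apply (filterlim_Rcomp (fun r => exp (s * ln (sqrt r)))
             (fun x => Re (f x) ^ 2 + Im (f x) ^ 2) (Re w ^ 2 + Im w ^ 2)).
    - apply filterlim_Rplus.
      + apply (filterlim_Rcomp (fun x => x ^ 2)); [exact H1|auto_derive; exact I].
      + apply (filterlim_Rcomp (fun x => x ^ 2)); [exact H2|auto_derive; exact I].
    - auto_derive; split; [exact Hpos|split; [now apply sqrt_lt_R0|exact I]]. }
  assert (Harg : filterlim (fun x => s * atan (Im (f x) / Re (f x))) F
                   (locally (s * atan (Im w / Re w)))).
  { apply filterlim_Rmult; [apply filterlim_const|].
    apply (filterlim_Rcomp atan).
    - apply filterlim_Rmult; [exact H2|].
      apply (filterlim_Rcomp Rinv); [exact H1|].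
      auto_derive; lra.
    - eexists; apply is_derive_atan. }
  apply filterlim_Cmult; apply filterlim_C; simpl.
  - exact Hmod.
  - apply filterlim_const.
  - apply (filterlim_Rcomp cos); [exact Harg|auto_derive; exact I].
  - apply (filterlim_Rcomp sin); [exact Harg|auto_derive; exact I].
Qed.

End Filterlim_C.

Definition closed_disk (z : C) : Prop := Cmod z <= 1.

Lemma Rabs_mult_le_1 x y : Rabs y <= 1 -> Rabs (x * y) <= Rabs x.
Proof. intros H; rewrite Rabs_mult; assert (H1 := Rabs_pos x); nra. Qed.

Lemma Cpow_parts_le_1 z n : closed_disk z ->
  Rabs (Re (Cpow z n)) <= 1 /\ Rabs (Im (Cpow z n)) <= 1.
Proof.
  intros Hz; assert (H : Cmod (Cpow z n) <= 1).
  { rewrite Cmod_pow, <- (pow1 n); apply pow_incr.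
    split; [apply Cmod_ge_0|exact Hz]. }
  assert (H1 := Re_le_Cmod (Cpow z n)); assert (H2 := Im_le_Cmod (Cpow z n)); lra.
Qed.

Lemma filterlim_Cpow {F : (C -> Prop) -> Prop} {FF : Filter F} (z0 : C) (n : nat) :
  filterlim (fun z => z) F (locally (T := C_UniformSpace) z0) ->
  filterlim (fun z => Cpow z n) F (locally (T := C_UniformSpace) (Cpow z0 n)).
Proof.
  intros H; induction n as [|n IH]; simpl; [apply filterlim_const|].
  now apply (filterlim_Cmult (fun z => z)).
Qed.

Lemma filterlim_within_id (D : C -> Prop) (z0 : C) :
  filterlim (fun z => z) (within D (locally (T := C_UniformSpace) z0))
    (locally (T := C_UniformSpace) z0).
Proof.
  intros P HP; unfold filtermap, within.
  revert HP; apply filter_imp; auto.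
Qed.

Lemma csum_continuous (g : nat -> R) (z0 : C) :
  ex_series (fun n => Rabs (g n)) -> closed_disk z0 ->
  filterlim (csum g) (within closed_disk (locally (T := C_UniformSpace) z0))
    (locally (T := C_UniformSpace) (csum g z0)).
Proof.
  intros Hg Hz0.
  assert (Hpow := fun n => filterlim_Cpow z0 n
                    (filterlim_within_id closed_disk z0)).
  apply filterlim_C; simpl.
  - apply (filterlim_Series (fun z n => g n * Re (Cpow z n)) _ (fun n => Rabs (g n)) Hg).
    + intros n; apply Rabs_mult_le_1; now apply Cpow_parts_le_1.
    + unfold within; apply filter_forall; intros z Hz n.
      apply Rabs_mult_le_1; now apply Cpow_parts_le_1.
    + intros n; apply filterlim_Rmult; [apply filterlim_const|].
      apply (filterlim_Re_Im _ _ (Hpow n)).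
  - apply (filterlim_Series (fun z n => g n * Im (Cpow z n)) _ (fun n => Rabs (g n)) Hg).
    + intros n; apply Rabs_mult_le_1; now apply Cpow_parts_le_1.
    + unfold within; apply filter_forall; intros z Hz n.
      apply Rabs_mult_le_1; now apply Cpow_parts_le_1.
    + intros n; apply filterlim_Rmult; [apply filterlim_const|].
      apply (filterlim_Re_Im _ _ (Hpow n)).
Qed.

Lemma csum_bound (g : nat -> R) (z : C) :
  ex_series (fun n => Rabs (g n)) -> closed_disk z ->
  Cmod (csum g z) <= 2 * Series (fun n => Rabs (g n)).
Proof.
  intros Hg Hz.
  assert (Hpart : forall p : nat -> R, (forall n, Rabs (p n) <= 1) ->
    Rabs (Series (fun n => g n * p n)) <= Series (fun n => Rabs (g n))).
  { intros p Hp; eapply Rle_trans; [apply Series_Rabs|apply Series_le; [|exact Hg]].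
    - apply (ex_series_le (K := R_AbsRing) (V := R_CompleteNormedModule) _ _) with (2 := Hg).
      intros n; change norm with Rabs; rewrite Rabs_Rabsolu; now apply Rabs_mult_le_1.
    - intros n; split; [apply Rabs_pos|now apply Rabs_mult_le_1]. }
  assert (H1 := Hpart _ (fun n => proj1 (Cpow_parts_le_1 z n Hz))).
  assert (H2 := Hpart _ (fun n => proj2 (Cpow_parts_le_1 z n Hz))).
  replace (csum g z) with (Cplus (RtoC (Re (csum g z))) (Cmult Ci (RtoC (Im (csum g z))))).
  2: { unfold Cplus, Cmult, Ci, RtoC, Re, Im, csum; simpl; f_equal; ring. }
  eapply Rle_trans; [apply Cmod_triangle|].
  rewrite Cmod_mult, Cmod_Ci, !Cmod_R, Rmult_1_l; simpl; lra.
Qed.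

Lemma is_series_C (u : nat -> C) (l1 l2 : R) :
  is_series (fun n => Re (u n)) l1 -> is_series (fun n => Im (u n)) l2 ->
  is_series (K := C_AbsRing) (V := C_NormedModule) u (l1, l2).
Proof.
  intros H1 H2.
  apply (filterlim_ext (fun n => (sum_n (fun n => Re (u n)) n, sum_n (fun n => Im (u n)) n))).
  - intros n; induction n as [|n IH].
    + rewrite !sum_O; now rewrite (surjective_pairing (u O)).
    + rewrite !sum_Sn, <- IH; reflexivity.
  - apply (filterlim_C (F := eventually)); assumption.
Qed.

(** * Behaviour of the hypergeometric function on the closed disk *)

Lemma hyp2F1_expansion a b c d K z :
  let g := fun n => hyp_coef a b c n - K * bin_coef d n in
  0 < d < 1 -> ex_series (fun n => Rabs (g n)) -> unit_disk z ->
  hyp2F1 a b c z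
  = Cplus (Cmult (RtoC K) (cpower (Cminus (RtoC 1) z) (- d))) (csum g z).
Proof.
  intros g Hd Hg Hz; unfold unit_disk in Hz.
  rewrite <- binomial_series by assumption.
  assert (Hpart : forall p : C -> R, (forall w, Rabs (p w) <= Cmod w) ->
    is_series (fun n => hyp_coef a b c n * p (Cpow z n))
      (K * Series (fun n => bin_coef d n * p (Cpow z n))
       + Series (fun n => g n * p (Cpow z n)))).
  { intros p Hp.
    assert (Hpz : forall n, Rabs (p (Cpow z n)) <= Cmod z ^ n).
    { intros n; rewrite <- Cmod_pow; apply Hp. }
    assert (Hm := Cmod_ge_0 z).
    assert (E1 : ex_series (fun n => bin_coef d n * p (Cpow z n))).
    { apply (ex_series_le (K := R_AbsRing) (V := R_CompleteNormedModule) _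
               (fun n => Cmod z ^ n)).
      - intros n; change norm with Rabs; rewrite Rabs_mult.
        destruct (bin_coef_bounds d n Hd) as [Hb0 Hb1].
        rewrite Rabs_pos_eq by lra.
        assert (H := Hpz n); assert (H0 := Rabs_pos (p (Cpow z n))); nra.
      - apply ex_series_geom; rewrite Rabs_pos_eq; assumption. }
    assert (E2 : ex_series (fun n => g n * p (Cpow z n))).
    { apply (ex_series_le (K := R_AbsRing) (V := R_CompleteNormedModule) _
               (fun n => Rabs (g n))); [|exact Hg].
      intros n; apply Rabs_mult_le_1.
      eapply Rle_trans; [apply Hpz|].
      rewrite <- (pow1 n); apply pow_incr; lra. }
    apply (is_series_ext (K := R_AbsRing) (V := R_NormedModule)
      (fun n => K * (bin_coef d n * p (Cpow z n)) + g n * p (Cpow z n))).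
    - intros n; simpl; unfold g; ring.
    - apply (is_series_plus (K := R_AbsRing) (V := R_NormedModule)
               (fun n => K * (bin_coef d n * p (Cpow z n))) (fun n => g n * p (Cpow z n))).
      + apply (is_series_scal (K := R_AbsRing) (V := R_NormedModule) K
                 (fun n => bin_coef d n * p (Cpow z n))).
        now apply Series_correct.
      + now apply Series_correct. }
  apply (iota_filterlim_locally (K := C_AbsRing) (V := C_CompleteNormedModule)
           (F := eventually) _).
  assert (H : is_series (K := C_AbsRing) (V := C_NormedModule)
    (fun n => Cmult (RtoC (hyp_coef a b c n)) (Cpow z n))
    (K * Series (fun n => bin_coef d n * Re (Cpow z n))
       + Series (fun n => g n * Re (Cpow z n)),
     K * Series (fun n => bin_coef d n * Im (Cpow z n))
       + Series (fun n => g n * Im (Cpow z n)))).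
  { apply is_series_C.
    - eapply (is_series_ext (K := R_AbsRing) (V := R_NormedModule));
        [|exact (Hpart Re Re_le_Cmod)].
      intros n; unfold Cmult, RtoC, Re, Im; simpl; ring.
    - eapply (is_series_ext (K := R_AbsRing) (V := R_NormedModule));
        [|exact (Hpart Im Im_le_Cmod)].
      intros n; unfold Cmult, RtoC, Re, Im; simpl; ring. }
  match goal with |- filterlim _ _ (locally ?l) =>
    replace l with
      ((K * Series (fun n => bin_coef d n * Re (Cpow z n))
        + Series (fun n => g n * Re (Cpow z n)),
        K * Series (fun n => bin_coef d n * Im (Cpow z n))
        + Series (fun n => g n * Im (Cpow z n))) : C)
  end.
  - exact H.
  - unfold csum, Cplus, Cmult, RtoC; simpl; f_equal; ring.
Qed.

Lemma Cmod_cis t : Cmod (cis t) = 1.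
Proof.
  unfold Cmod, cis; simpl.
  replace (_ + _) with (Rsqr (sin t) + Rsqr (cos t)) by (unfold Rsqr; ring).
  rewrite sin2_cos2; apply sqrt_1.
Qed.

Lemma Cmod_cpower w s : Cmod (cpower w s) = exp (s * ln (Cmod w)).
Proof.
  unfold cpower; rewrite Cmod_mult, Cmod_cis, Cmod_R, Rabs_pos_eq; [ring|].
  left; apply exp_pos.
Qed.

Lemma exp_ln_antimono d x y : 0 <= d -> 0 < x <= y -> exp (- d * ln y) <= exp (- d * ln x).
Proof.
  intros Hd [Hx Hxy]; assert (Hln := ln_le _ _ Hx Hxy).
  assert (Hle : - d * ln y <= - d * ln x) by nra.
  destruct Hle as [Hlt|Heq]; [left; now apply exp_increasing|right; now rewrite Heq].
Qed.

Lemma closed_disk_Re z : closed_disk z -> z <> RtoC 1 -> 0 < Re (Cminus (RtoC 1) z).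
Proof.
  intros Hz Hz1; unfold closed_disk in Hz.
  assert (H := Re_le_Cmod z); assert (H2 := Cmod2_alt z).
  assert (H0 := Cmod_ge_0 z).
  destruct z as [x y]; unfold Cminus, Cplus, Copp, RtoC, Re, Im in *; simpl in *.
  apply Rabs_le_between in H.
  destruct (Rlt_or_le x 1) as [Hx|Hx]; [lra|].
  exfalso; apply Hz1.
  assert (x = 1) by lra; subst x.
  f_equal; nra.
Qed.

(** On the closed disk [f] has the form [z (K (1 - z)^(-d) + G z)] with [G]
    continuous up to the boundary and [G 1 = B]. *)
Lemma boundary_behaviour a b c d :
  0 < a -> 0 < b -> 0 < c -> 0 < d < 1 -> a + b = c + d ->
  let f := shifted_hyp2F1 a b c in
  let B := RtoC (Gamma c * Gamma (- d) * (rGamma (c - a) * rGamma (c - b))) in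
  exists (K : R) (fb : C -> C), 0 < K /\
    (forall z, unit_disk z -> f z = fb z) /\
    (forall z, closed_disk z -> z <> RtoC 1 ->
       filterlim fb (within closed_disk (locally (T := C_UniformSpace) z))
         (locally (T := C_UniformSpace) (fb z))) /\
    (forall eps, 0 < eps -> exists eta, 0 < eta /\
       forall z, closed_disk z -> z <> RtoC 1 -> Cmod (Cminus (RtoC 1) z) < eta ->
         Cmod (Cminus (fb z)
                 (Cplus B (Cmult (RtoC K) (cpower (Cminus (RtoC 1) z) (- d))))) < eps) /\
    (forall eta, 0 < eta -> exists M,
       forall z, unit_disk z -> eta <= Cmod (Cminus (RtoC 1) z) -> Cmod (f z) <= M).
Proof.
  intros Ha Hb Hc Hd Hs f B.
  destruct (hyp_coef_remainder a b c d Ha Hb Hc Hd Hs) as [K [HK [Hg HB]]].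
  set (g := fun n => hyp_coef a b c n - K * bin_coef d n) in *.
  set (P := fun z => cpower (Cminus (RtoC 1) z) (- d)).
  exists K, (fun z => Cmult z (Cplus (Cmult (RtoC K) (P z)) (csum g z))).
  assert (Hf : forall z, unit_disk z ->
    f z = Cmult z (Cplus (Cmult (RtoC K) (P z)) (csum g z))).
  { intros z Hz; unfold f, shifted_hyp2F1; f_equal.
    now apply (hyp2F1_expansion a b c d K z). }
  split; [exact HK|split; [exact Hf|split; [|split]]].
  - intros z Hz Hz1.
    apply (filterlim_Cmult (fun z => z)); [apply filterlim_within_id|].
    apply filterlim_Cplus; [|now apply csum_continuous].
    apply filterlim_Cmult; [apply filterlim_const|].
    apply (filterlim_cpower (- d) (fun z => Cminus (RtoC 1) z)).
    + now apply closed_disk_Re.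
    + apply filterlim_Cplus; [apply filterlim_const|].
      apply (filterlim_ext (fun z => Cmult (RtoC (-1)) z)).
      * intros w; unfold Cmult, Copp, RtoC; simpl; destruct w; simpl; f_equal; ring.
      * replace (Copp z) with (Cmult (RtoC (-1)) z).
        -- apply (filterlim_Cmult (fun _ => RtoC (-1)) (fun z => z));
             [apply filterlim_const|apply filterlim_within_id].
        -- unfold Cmult, Copp, RtoC; simpl; destruct z; simpl; f_equal; ring.
  - intros eps Heps.
    assert (H1 : closed_disk (RtoC 1)) by (unfold closed_disk; rewrite Cmod_1; lra).
    assert (HG : filterlim (fun z => Cmult z (csum g z))
                   (within closed_disk (locally (T := C_UniformSpace) (RtoC 1)))
                   (locally (T := C_UniformSpace) B)).
    { replace B with (Cmult (RtoC 1) (csum g (RtoC 1))).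
      - apply (filterlim_Cmult (fun z => z)); [apply filterlim_within_id|].
        now apply csum_continuous.
      - rewrite Cmult_1_l; unfold B; rewrite <- HB; unfold csum, RtoC; f_equal.
        + apply Series_ext; intros n; change (1, 0) with (RtoC 1).
          rewrite Cpow_1_l; unfold Re; simpl; unfold g; ring.
        + rewrite (Series_ext _ (fun n => 0 * g n)).
          * rewrite Series_scal_l; ring.
          * intros n; change (1, 0) with (RtoC 1).
            rewrite Cpow_1_l; unfold Im; simpl; ring. }
    assert (HBe : locally (T := C_UniformSpace) B (fun w => Cmod (Cminus w B) < eps / 2)).
    { apply locally_Cmod; exists (eps / 2); split; [lra|auto]. }
    assert (HGe := HG _ HBe).
    apply locally_Cmod in HGe; destruct HGe as [eta1 [Heta1 HGe]].
    assert (HeK : 0 < eps / (2 * K)) by (apply Rdiv_lt_0_compat; lra).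
    exists (Rmin eta1 (exp (ln (eps / (2 * K)) / (1 - d)))).
    split; [apply Rmin_pos; [exact Heta1|apply exp_pos]|].
    intros z Hz Hz1 Hlt.
    set (m := Cmod (Cminus (RtoC 1) z)) in *.
    assert (Hm : 0 < m).
    { apply Cmod_gt_0; intros E; apply Hz1.
      replace z with (Cminus (RtoC 1) (Cminus (RtoC 1) z)) by ring.
      rewrite E; ring. }
    assert (Hm1 := Rlt_le_trans _ _ _ Hlt (Rmin_l _ _)).
    assert (Hm2 := Rlt_le_trans _ _ _ Hlt (Rmin_r _ _)).
    assert (G1 : Cmod (Cminus (Cmult z (csum g z)) B) < eps / 2).
    { apply HGe; [|exact Hz].
      replace (Cminus z (RtoC 1)) with (Copp (Cminus (RtoC 1) z)) by ring.
      now rewrite Cmod_opp. }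
    assert (G2 : Cmod (Cmult (RtoC K) (Cmult (Cminus (RtoC 1) z) (P z))) < eps / 2).
    { unfold P; rewrite !Cmod_mult, Cmod_cpower, Cmod_R, Rabs_pos_eq by lra.
      fold m.
      replace (m * exp (- d * ln m)) with (exp ((1 - d) * ln m)).
      2: { rewrite <- (exp_ln m Hm) at 2; rewrite <- exp_plus; f_equal; ring. }
      apply Rmult_lt_reg_l with (/ K); [now apply Rinv_0_lt_compat|].
      rewrite <- Rmult_assoc, Rinv_l, Rmult_1_l by lra.
      replace (/ K * (eps / 2)) with (eps / (2 * K)) by (field; lra).
      rewrite <- (exp_ln (eps / (2 * K)) HeK); apply exp_increasing.
      apply ln_increasing in Hm2; [|exact Hm].
      rewrite ln_exp in Hm2.
      apply Rmult_lt_compat_l with (r := 1 - d) in Hm2; [|lra].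
      replace ((1 - d) * (ln (eps / (2 * K)) / (1 - d)))
        with (ln (eps / (2 * K))) in Hm2 by (field; lra).
      exact Hm2. }
    (* [f - B - K P] is [(z G - B) - K (1 - z) P]. *)
    replace (Cminus _ _) with
      (Cplus (Cminus (Cmult z (csum g z)) B)
             (Copp (Cmult (RtoC K) (Cmult (Cminus (RtoC 1) z) (P z))))) by (unfold P; ring).
    eapply Rle_lt_trans; [apply Cmod_triangle|]; rewrite Cmod_opp; lra.
  - intros eta Heta.
    exists (K * exp (- d * ln eta) + 2 * Series (fun n => Rabs (g n))).
    intros z Hz Hle; rewrite (Hf z Hz), Cmod_mult.
    unfold unit_disk in Hz.
    assert (G0 := Cmod_ge_0 (Cplus (Cmult (RtoC K) (P z)) (csum g z))).
    assert (G := Cmod_triangle (Cmult (RtoC K) (P z)) (csum g z)).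
    assert (Hcb := csum_bound g z Hg (Rlt_le _ _ Hz)).
    assert (HP : Cmod (Cmult (RtoC K) (P z)) <= K * exp (- d * ln eta)).
    { unfold P; rewrite Cmod_mult, Cmod_cpower, Cmod_R, Rabs_pos_eq by lra.
      apply Rmult_le_compat_l; [lra|].
      apply exp_ln_antimono; lra. }
    apply Rle_trans with (1 * Cmod (Cplus (Cmult (RtoC K) (P z)) (csum g z))).
    + apply Rmult_le_compat_r; lra.
    + lra.
Qed.

(** * Sectors as intersections of half-planes *)

Lemma C_ext (z w : C) : Re z = Re w -> Im z = Im w -> z = w.
Proof. destruct z, w; simpl; intros -> ->; reflexivity. Qed.

Lemma cis_plus s t : cis (s + t) = Cmult (cis s) (cis t).
Proof.
  apply C_ext; unfold cis, Cmult; simpl; [rewrite cos_plus|rewrite sin_plus]; ring.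
Qed.

Lemma polar_right w : 0 < Re w -> w = Cmult (RtoC (Cmod w)) (cis (atan (Im w / Re w))).
Proof.
  intros Hw.
  assert (Hm : Cmod w = Re w * sqrt (1 + Rsqr (Im w / Re w))).
  { assert (H0 : 0 <= 1 + Rsqr (Im w / Re w))
      by (assert (H := Rle_0_sqr (Im w / Re w)); lra).
    rewrite <- (sqrt_Rsqr (Re w)) at 1 by lra.
    rewrite <- sqrt_mult by (try apply Rle_0_sqr; exact H0).
    unfold Cmod; f_equal; unfold Rsqr, Re, Im in *; simpl; field; lra. }
  assert (Hs : 0 < sqrt (1 + Rsqr (Im w / Re w))).
  { apply sqrt_lt_R0; assert (H := Rle_0_sqr (Im w / Re w)); lra. }
  rewrite Hm; apply C_ext; unfold cis, Cmult, RtoC; simpl;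
    rewrite sin_atan, cos_atan; unfold Re, Im in *; field; lra.
Qed.

Lemma cpower_polar r t s : 0 < r -> - (PI / 2) < t < PI / 2 ->
  cpower (Cmult (RtoC r) (cis t)) s = Cmult (RtoC (exp (s * ln r))) (cis (s * t)).
Proof.
  intros Hr Ht; unfold cpower.
  rewrite Cmod_mult, Cmod_cis, Cmod_R, Rabs_pos_eq, Rmult_1_r by lra.
  assert (Hc : 0 < cos t) by (apply cos_gt_0; lra).
  replace (Im (Cmult (RtoC r) (cis t)) / Re (Cmult (RtoC r) (cis t))) with (tan t).
  - rewrite atan_tan; [reflexivity|lra].
  - unfold Re, Im, Cmult, cis, RtoC, tan; simpl; field; split; [lra|nra].
Qed.

(** For [s = 1] and [s = -1] the sign of [side s al v (z - q)] tells on which side of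
    the edge of direction [v cis (s al)] the point [z] lies; inside the sector it is
    negative.  The conjugate of [v] stands for its inverse, up to a positive factor. *)
Definition side (s al : R) (v x : C) : R :=
  s * Im (Cmult (Cmult (cis (- (s * al))) (Cconj v)) x).

Lemma side_formula s al v x :
  side s al v x
  = s * (cos (s * al) * (Re v * Im x - Im v * Re x)
         - sin (s * al) * (Re v * Re x + Im v * Im x)).
Proof.
  unfold side, cis, Cmult, Cconj, Re, Im; simpl; rewrite cos_neg, sin_neg; ring.
Qed.

Lemma side_plus s al v x y : side s al v (Cplus x y) = side s al v x + side s al v y.
Proof. rewrite !side_formula; unfold Cplus, Re, Im; simpl; ring. Qed.

Lemma side_scal s al v t x : side s al v (Cmult (RtoC t) x) = t * side s al v x.
Proof. rewrite !side_formula; unfold Cmult, RtoC, Re, Im; simpl; ring. Qed.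

Definition is_sign (s : R) : Prop := s = 1 \/ s = -1.

Lemma side_bound s al v x : is_sign s -> Rabs (side s al v x) <= Cmod v * Cmod x.
Proof.
  intros Hs; unfold side; rewrite Rabs_mult.
  replace (Rabs s) with 1.
  2: { destruct Hs as [->| ->]; [now rewrite Rabs_R1|].
       rewrite Rabs_left; lra. }
  rewrite Rmult_1_l; eapply Rle_trans; [apply Im_le_Cmod|].
  rewrite !Cmod_mult, Cmod_cis, Cmod_conj; lra.
Qed.

Lemma side_cis s al v w psi :
  side s al v (Cmult w (cis psi))
  = s * (cos (psi - s * al) * (Re v * Im w - Im v * Re w)
         + sin (psi - s * al) * (Re v * Re w + Im v * Im w)).
Proof.
  rewrite side_formula, cos_minus, sin_minus.
  unfold Cmult, cis, Re, Im; simpl; ring.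
Qed.

Lemma sector_sides q v be w : v <> RtoC 0 -> 0 < be < PI / 2 ->
  sector q v be w <-> (forall s, is_sign s -> side s be v (Cminus w q) < 0).
Proof.
  intros Hv Hbe.
  assert (HPI := PI_RGT_0).
  unfold sector; set (ze := Cdiv (Cminus w q) v).
  assert (Hm : 0 < Cmod v ^ 2) by (apply pow_lt, Cmod_gt_0, Hv).
  assert (Hside : forall s, side s be v (Cminus w q)
            = Cmod v ^ 2 * (s * (cos (s * be) * Im ze - sin (s * be) * Re ze))).
  { intros s; replace (Cminus w q) with (Cmult v ze) by (unfold ze; now field).
    rewrite side_formula, Cmod2_alt; unfold Cmult, Re, Im; simpl; ring. }
  assert (Hsin : 0 < sin be) by (apply sin_gt_0; lra).
  assert (Hcos : 0 < cos be) by (apply cos_gt_0; lra).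
  split.
  - intros [t [[Hz0 [_ Hz]] Ht]] s Hs; apply Rabs_def2 in Ht.
    assert (Hze : 0 < Cmod ze) by now apply Cmod_gt_0.
    rewrite Hside.
    assert (HR : Re ze = Cmod ze * cos t)
      by (rewrite Hz at 1; unfold Re, Cmult, cis, RtoC; simpl; ring).
    assert (HI : Im ze = Cmod ze * sin t)
      by (rewrite Hz at 1; unfold Im, Cmult, cis, RtoC; simpl; ring).
    rewrite HR, HI.
    replace (s * (cos (s * be) * (Cmod ze * sin t) - sin (s * be) * (Cmod ze * cos t)))
      with (- (Cmod ze * - (s * sin (t - s * be)))) by (rewrite sin_minus; ring).
    assert (H : 0 < - (s * sin (t - s * be))).
    { destruct Hs as [->| ->].
      - rewrite <- Ropp_mult_distr_r_reverse, <- sin_neg, Rmult_1_l.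
        apply sin_gt_0; lra.
      - replace (t - -1 * be) with (t + be) by ring.
        assert (H := sin_gt_0 (t + be)); lra. }
    assert (H1 := Rmult_lt_0_compat _ _ Hze H); nra.
  - intros H.
    assert (H1 := H 1 (or_introl eq_refl)); assert (H2 := H (-1) (or_intror eq_refl)).
    rewrite Hside in H1, H2.
    replace (-1 * be) with (- be) in H2 by ring.
    rewrite cos_neg, sin_neg in H2; rewrite !Rmult_1_l in H1.
    assert (G1 : cos be * Im ze - sin be * Re ze < 0) by nra.
    assert (G2 : - (cos be * Im ze + sin be * Re ze) < 0) by nra.
    assert (HR : 0 < Re ze) by nra.
    exists (atan (Im ze / Re ze)).
    assert (Hb := atan_bound (Im ze / Re ze)).
    assert (Htan : sin be / cos be = tan be) by reflexivity.
    assert (K1 : Im ze / Re ze < tan be).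
    { rewrite <- Htan; apply Rmult_lt_reg_r with (Re ze * cos be); [nra|].
      replace (Im ze / Re ze * (Re ze * cos be)) with (cos be * Im ze) by (field; lra).
      replace (sin be / cos be * (Re ze * cos be)) with (sin be * Re ze) by (field; lra).
      lra. }
    assert (K2 : tan (- be) < Im ze / Re ze).
    { rewrite tan_neg, <- Htan; apply Rmult_lt_reg_r with (Re ze * cos be); [nra|].
      replace (Im ze / Re ze * (Re ze * cos be)) with (cos be * Im ze) by (field; lra).
      replace (- (sin be / cos be) * (Re ze * cos be))
        with (- (sin be * Re ze)) by (field; lra).
      lra. }
    apply atan_increasing in K1; apply atan_increasing in K2.
    rewrite atan_tan in K1, K2 by lra.
    split; [split; [|split]|].
    + intros E; rewrite E in HR; unfold Re, RtoC in HR; simpl in HR; lra.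
    + lra.
    + now apply polar_right.
    + apply Rabs_def1; lra.
Qed.

(** * Sets asymptotic to both edges of a sector *)

(** What the inclusion and the optimality need to know about the end of a boundary
    curve, expressed by points of [E] itself. *)
Definition approaches_ray (E : C -> Prop) (p u : C) : Prop :=
  forall eps M, 0 < eps ->
    exists w r, E w /\ M < r /\ Cmod (Cminus w (Cplus p (Cmult (RtoC r) u))) < eps.

(** Divide the inequality at a point near [p + r u] by [r] and let [r] grow; if the
    term in [r] vanishes, what remains is the inequality at [p]. *)
Lemma half_plane_ray (E : C -> Prop) p u s al v q :
  is_sign s -> approaches_ray E p u ->
  (forall w, E w -> side s al v (Cminus w q) < 0) ->
  side s al v u <= 0 /\
  (side s al v u = 0 -> side s al v (Cminus p q) <= 0).
Proof.
  intros Hs Hray HE.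
  assert (Hmv := Cmod_ge_0 v).
  assert (Hkey : forall eps M, 0 < eps -> exists r, M < r /\
    side s al v (Cminus p q) + r * side s al v u < Cmod v * eps).
  { intros eps M Heps; destruct (Hray eps M Heps) as [w [r [Hw [Hr He]]]].
    exists r; split; [exact Hr|].
    assert (H := HE w Hw).
    replace (Cminus w q) with
      (Cplus (Cplus (Cminus p q) (Cmult (RtoC r) u))
             (Cminus w (Cplus p (Cmult (RtoC r) u)))) in H by ring.
    rewrite !side_plus, side_scal in H.
    assert (H1 := side_bound s al v (Cminus w (Cplus p (Cmult (RtoC r) u))) Hs).
    apply Rabs_le_between in H1.
    assert (H2 : Cmod v * Cmod (Cminus w (Cplus p (Cmult (RtoC r) u))) <= Cmod v * eps)
      by (apply Rmult_le_compat_l; lra).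
    lra. }
  split.
  - apply Rnot_lt_le; intros Hpos.
    destruct (Hkey 1 ((Cmod v + Rabs (side s al v (Cminus p q))) / side s al v u) Rlt_0_1)
      as [r [Hr H]].
    apply Rlt_div_l in Hr; [|exact Hpos].
    assert (H1 := Rle_abs (- side s al v (Cminus p q))); rewrite Rabs_Ropp in H1; lra.
  - intros H0; apply Rnot_lt_le; intros Hpos.
    assert (Heps : 0 < side s al v (Cminus p q) / (Cmod v + 1))
      by (apply Rdiv_lt_0_compat; lra).
    destruct (Hkey _ 0 Heps) as [r [_ H]].
    rewrite H0, Rmult_0_r, Rplus_0_r in H.
    assert (H1 : Cmod v * (side s al v (Cminus p q) / (Cmod v + 1))
                 = side s al v (Cminus p q)
                   - side s al v (Cminus p q) / (Cmod v + 1)) by (field; lra).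
    lra.
Qed.

(** The inner sector contains rays of all its directions, which must be directions of
    the outer one; a direction slightly beyond [al] is excluded. *)
Lemma sector_opening_le p al q v be :
  0 < al < PI / 2 -> v <> RtoC 0 -> 0 < be <= PI ->
  subset (sector q v be) (sector p (RtoC 1) al) -> be <= al.
Proof.
  intros Hal Hv Hbe Hsub.
  assert (HPI := PI_RGT_0).
  assert (H1 : RtoC 1 <> RtoC 0) by (intros E; injection E; lra).
  apply Rnot_lt_le; intros Hlt.
  assert (Hray : forall psi s, Rabs psi < be -> is_sign s ->
    side s al (RtoC 1) (Cmult v (cis psi)) <= 0).
  { intros psi s Hpsi Hs.
    apply (half_plane_ray (sector q v be) q (Cmult v (cis psi)) s al (RtoC 1) p Hs).
    - intros eps M Heps.
      set (r := Rmax M 0 + 1).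
      assert (Hr : M < r /\ 0 < r)
        by (unfold r; assert (G1 := Rmax_l M 0); assert (G2 := Rmax_r M 0); lra).
      exists (Cplus q (Cmult (RtoC r) (Cmult v (cis psi)))), r.
      split; [|split; [tauto|]].
      + exists psi; split; [|exact Hpsi].
        replace (Cdiv (Cminus (Cplus q (Cmult (RtoC r) (Cmult v (cis psi)))) q) v)
          with (Cmult (RtoC r) (cis psi)) by now field.
        assert (Hm : Cmod (Cmult (RtoC r) (cis psi)) = r)
          by (rewrite Cmod_mult, Cmod_cis, Cmod_R, Rabs_pos_eq; lra).
        apply Rabs_def2 in Hpsi.
        split; [|split; [lra|now rewrite Hm]].
        apply Cmod_gt_0; lra.
      + unfold Cminus; rewrite Cplus_opp_r, Cmod_0; exact Heps.
    - intros w Hw; now apply (proj1 (sector_sides p (RtoC 1) al w H1 Hal) (Hsub w Hw)). }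
  (* The directions [al] and [- al] force [v] to be real, the direction [0] forces
     [v > 0], and a direction between [al] and [be] gives the contradiction. *)
  assert (Hdir : forall psi s, Rabs psi < be -> is_sign s ->
    s * (cos (psi - s * al) * Im v + sin (psi - s * al) * Re v) <= 0).
  { intros psi s Hpsi Hs; assert (H := Hray psi s Hpsi Hs).
    rewrite side_cis in H; unfold RtoC in H; simpl in H.
    unfold Re, Im in *; simpl in *; lra. }
  assert (Hs1 : is_sign 1) by now left.
  assert (Hs2 : is_sign (-1)) by now right.
  assert (Him : Im v = 0).
  { assert (G1 := Hdir al 1 ltac:(rewrite Rabs_pos_eq; lra) Hs1).
    assert (G2 := Hdir (- al) (-1) ltac:(rewrite Rabs_Ropp, Rabs_pos_eq; lra) Hs2).
    replace (al - 1 * al) with 0 in G1 by ring.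
    replace (- al - -1 * al) with 0 in G2 by ring.
    rewrite cos_0, sin_0 in *; lra. }
  assert (Hre : 0 < Re v).
  { assert (G := Hdir 0 1 ltac:(rewrite Rabs_R0; lra) Hs1).
    replace (0 - 1 * al) with (- al) in G by ring.
    rewrite Him, sin_neg in G.
    assert (Hsin : 0 < sin al) by (apply sin_gt_0; lra).
    destruct (Rtotal_order (Re v) 0) as [Hn|[Hn|Hn]]; [nra| |exact Hn].
    exfalso; apply Hv; now apply C_ext. }
  assert (G := Hdir ((al + be) / 2) 1 ltac:(rewrite Rabs_pos_eq; lra) Hs1).
  assert (Hsin : 0 < sin ((al + be) / 2 - 1 * al)) by (apply sin_gt_0; lra).
  rewrite Him in G; nra.
Qed.

(** The asymptotic directions force a competing sector to have the same axis and
    opening; each edge is then parallel to an edge of the given sector and lies on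
    its outer side. *)
Lemma asymptotic_sector_optimal (E : C -> Prop) p al :
  0 < al < PI / 2 ->
  (forall s, is_sign s -> approaches_ray E p (cis (s * al))) ->
  optimal_sector E p (RtoC 1) al.
Proof.
  intros Hal Hrays q v be Hv Hbe HE Hcomp.
  assert (HPI := PI_RGT_0).
  assert (H1 : RtoC 1 <> RtoC 0) by (intros E1; injection E1; lra).
  assert (Hle : be <= al).
  { destruct Hcomp as [Hsub|Hle]; [|exact Hle].
    now apply (sector_opening_le p al q v be). }
  assert (Hbe2 : 0 < be < PI / 2) by lra.
  assert (HE' : forall s, is_sign s -> forall w, E w -> side s be v (Cminus w q) < 0).
  { intros s Hs w Hw.
    exact (proj1 (sector_sides q v be w Hv Hbe2) (HE w Hw) s Hs). }
  assert (Hedge := fun s s' Hs Hs' =>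
    half_plane_ray E p (cis (s' * al)) s be v q Hs (Hrays s' Hs') (HE' s Hs)).
  assert (Hs1 : is_sign 1) by now left.
  assert (Hs2 : is_sign (-1)) by now right.
  assert (Hdir : forall s s', is_sign s -> is_sign s' ->
    s * (sin (s' * al - s * be) * Re v - cos (s' * al - s * be) * Im v) <= 0).
  { intros s s' Hs Hs'; assert (H := proj1 (Hedge s s' Hs Hs')).
    rewrite <- (Cmult_1_l (cis (s' * al))), side_cis in H.
    unfold Re, Im, RtoC in *; simpl in *; lra. }
  assert (D1 := Hdir 1 1 Hs1 Hs1); assert (D2 := Hdir 1 (-1) Hs1 Hs2).
  assert (D3 := Hdir (-1) 1 Hs2 Hs1); assert (D4 := Hdir (-1) (-1) Hs2 Hs2).
  replace (1 * al - 1 * be) with (al - be) in D1 by ring.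
  replace (-1 * al - 1 * be) with (- (al + be)) in D2 by ring.
  replace (1 * al - -1 * be) with (al + be) in D3 by ring.
  replace (-1 * al - -1 * be) with (- (al - be)) in D4 by ring.
  rewrite sin_neg, cos_neg in D2, D4.
  (* [D2 + D3] gives [Re v >= 0]; then [D1 + D4] gives [sin (al - be) <= 0], and [D1],
     [D4] become [Im v = 0]. *)
  assert (Hsp : 0 < sin (al + be)) by (apply sin_gt_0; lra).
  assert (Hcm : 0 < cos (al - be)) by (apply cos_gt_0; lra).
  assert (Hre0 : 0 <= Re v) by nra.
  assert (Hre : 0 < Re v).
  { destruct Hre0 as [H|H]; [exact H|exfalso; apply Hv].
    apply C_ext; [now rewrite <- H|simpl; rewrite <- H in *; nra]. }
  assert (Hbeal : be = al).
  { apply Rle_antisym; [exact Hle|]; apply Rnot_lt_le; intros Hlt.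
    assert (Hsm : 0 < sin (al - be)) by (apply sin_gt_0; lra); nra. }
  subst be.
  replace (al - al) with 0 in D1, D4, Hcm by ring.
  rewrite sin_0, cos_0 in D1, D4.
  assert (Him : Im v = 0) by lra.
  assert (Hscale : forall s x, side s al v x = Re v * side s al (RtoC 1) x).
  { intros s x; rewrite !side_formula, Him; unfold RtoC, Re, Im; simpl; ring. }
  intros w Hw; apply (sector_sides q v al w Hv Hal); intros s Hs.
  assert (Hw' := proj1 (sector_sides p (RtoC 1) al w H1 Hal) Hw s Hs).
  replace (Cminus w q) with (Cplus (Cminus w p) (Cminus p q)) by ring.
  rewrite side_plus, (Hscale s (Cminus w p)).
  assert (H0 : side s al v (cis (s * al)) = 0).
  { rewrite <- (Cmult_1_l (cis (s * al))), side_cis, Him.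
    replace (s * al - s * al) with 0 by ring; rewrite sin_0.
    unfold RtoC, Re, Im; simpl; ring. }
  assert (H := proj2 (Hedge s s Hs Hs) H0); nra.
Qed.

(** The forms [side] are Lipschitz, so a point off both edges has a neighbourhood
    lying on the same sides of them. *)
Lemma sector_boundary p al z :
  0 < al < PI / 2 -> boundary (sector p (RtoC 1) al) z ->
  exists s t, is_sign s /\ z = Cplus p (Cmult (RtoC t) (cis (s * al))).
Proof.
  intros Hal Hz.
  assert (H1 : RtoC 1 <> RtoC 0) by (intros E1; injection E1; lra).
  assert (Hlip : forall s w, is_sign s ->
    Rabs (side s al (RtoC 1) (Cminus w p) - side s al (RtoC 1) (Cminus z p))
    <= Cmod (Cminus w z)).
  { intros s w Hs.
    replace (Cminus w p) with (Cplus (Cminus w z) (Cminus z p)) by ring.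
    rewrite side_plus; unfold Rminus; rewrite Rplus_assoc, Rplus_opp_r, Rplus_0_r.
    eapply Rle_trans; [now apply side_bound|]; rewrite Cmod_1; lra. }
  assert (Hle : forall s, is_sign s -> side s al (RtoC 1) (Cminus z p) <= 0).
  { intros s Hs; apply Rnot_lt_le; intros Hpos.
    destruct (Hz _ Hpos) as [[w [Hw Hd]] _].
    assert (G1 := proj1 (sector_sides p (RtoC 1) al w H1 Hal) Hw s Hs).
    assert (G2 := Hlip s w Hs); apply Rabs_le_between in G2; lra. }
  assert (Hzero : exists s, is_sign s /\ side s al (RtoC 1) (Cminus z p) = 0).
  { assert (Hs1 : is_sign 1) by now left.
    assert (Hs2 : is_sign (-1)) by now right.
    destruct (Rle_lt_or_eq_dec _ _ (Hle 1 Hs1)) as [L1|E1]; [|now exists 1].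
    destruct (Rle_lt_or_eq_dec _ _ (Hle (-1) Hs2)) as [L2|E2]; [|now exists (-1)].
    exfalso.
    set (m := Rmin (- side 1 al (RtoC 1) (Cminus z p))
                   (- side (-1) al (RtoC 1) (Cminus z p))).
    assert (Hm : 0 < m) by (apply Rmin_pos; lra).
    destruct (Hz m Hm) as [_ [w [Hw Hd]]]; apply Hw.
    apply (sector_sides p (RtoC 1) al w H1 Hal); intros s Hs.
    assert (G := Hlip s w Hs); apply Rabs_le_between in G.
    assert (M1 : m <= - side s al (RtoC 1) (Cminus z p)).
    { destruct Hs as [->| ->]; [apply Rmin_l|apply Rmin_r]. }
    lra. }
  destruct Hzero as [s [Hs H0]].
  exists s, (Re (Cmult (cis (- (s * al))) (Cminus z p))); split; [exact Hs|].
  assert (Hrot : Cmult (cis (- (s * al))) (Cminus z p)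
                 = RtoC (Re (Cmult (cis (- (s * al))) (Cminus z p)))).
  { apply C_ext; [reflexivity|].
    rewrite side_formula in H0.
    assert (Hs0 : s <> 0) by (destruct Hs; lra).
    apply Rmult_integral in H0; destruct H0 as [H0|H0]; [contradiction|].
    unfold RtoC, cis, Cmult, Re, Im in *; simpl in *.
    rewrite cos_neg, sin_neg; lra. }
  rewrite <- Hrot.
  replace (Cmult (Cmult (cis (- (s * al))) (Cminus z p)) (cis (s * al)))
    with (Cmult (Cmult (cis (- (s * al))) (cis (s * al))) (Cminus z p)) by ring.
  rewrite <- cis_plus, Rplus_opp_l.
  replace (cis 0) with (RtoC 1) by (unfold cis; rewrite cos_0, sin_0; reflexivity).
  ring.
Qed.

(** * Asymptotics along the unit circle *)

Lemma sin_lower_bound x : 0 <= x <= 1 -> x / 2 <= sin x.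
Proof.
  intros Hx.
  assert (HPI := PI2_1).
  destruct (sin_bound x 0) as [H _]; [lra|unfold PI2 in HPI; lra|].
  unfold sin_approx, sum_f_R0, sin_term in H; simpl in H.
  assert (H1 : x * x * x <= x) by nra.
  lra.
Qed.

Lemma Cmod_cis_minus_1 t : Cmod (Cminus (cis t) (RtoC 1)) <= Rabs t.
Proof.
  assert (Hmod : Cmod (Cminus (cis t) (RtoC 1)) = 2 * Rabs (sin (t / 2))).
  { assert (Hsq : Cmod (Cminus (cis t) (RtoC 1)) ^ 2 = (2 * Rabs (sin (t / 2))) ^ 2).
    { rewrite Cmod2_alt, Rpow_mult_distr, pow2_abs.
      unfold cis, Cminus, Cplus, Copp, RtoC, Re, Im; simpl.
      assert (Hc := cos_2a_sin (t / 2)).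
      replace (2 * (t / 2)) with t in Hc by field.
      assert (H := sin2_cos2 t); unfold Rsqr in H.
      transitivity (sin t * sin t + cos t * cos t + 1 - 2 * cos t); [ring|].
      rewrite H, Hc; ring. }
    rewrite <- (sqrt_pow2 (Cmod _)) by apply Cmod_ge_0.
    rewrite Hsq; apply sqrt_pow2.
    assert (H := Rabs_pos (sin (t / 2))); lra. }
  rewrite Hmod.
  assert (Hsin : forall x, 0 < x -> Rabs (sin x) <= x).
  { intros x Hx; apply Rabs_le.
    assert (H := sin_lt_x x Hx); assert (Hb := SIN_bound x).
    destruct (Rle_or_lt x 1) as [H1|H1]; [|lra].
    assert (H2 := sin_lower_bound x ltac:(lra)); lra. }
  destruct (Rtotal_order t 0) as [Ht|[->|Ht]].
  - assert (H := Hsin (- (t / 2)) ltac:(lra)).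
    rewrite sin_neg, Rabs_Ropp in H; rewrite (Rabs_left t) by exact Ht; lra.
  - replace (0 / 2) with 0 by field; rewrite sin_0, Rabs_R0; lra.
  - assert (H := Hsin (t / 2) ltac:(lra)); rewrite (Rabs_pos_eq t); lra.
Qed.

Lemma chord_polar s th : is_sign s ->
  Cminus (RtoC 1) (cis (s * th))
  = Cmult (RtoC (2 * sin (th / 2))) (cis (s * ((th - PI) / 2))).
Proof.
  intros Hs.
  assert (Hc := cos_2a_sin (th / 2)); assert (Hsn := sin_2a (th / 2)).
  replace (2 * (th / 2)) with th in Hc, Hsn by field.
  assert (G1 : cos ((th - PI) / 2) = sin (th / 2)).
  { rewrite <- cos_shift, <- cos_neg; f_equal; field. }
  assert (G2 : sin ((th - PI) / 2) = - cos (th / 2)).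
  { rewrite <- sin_shift, <- sin_neg; f_equal; field. }
  destruct Hs as [->| ->].
  - rewrite !Rmult_1_l; apply C_ext; unfold Cmult, Cminus, Cplus, Copp, cis, RtoC; simpl;
      rewrite G1, G2, ?Hc, ?Hsn; ring.
  - replace (-1 * th) with (- th) by ring.
    replace (-1 * ((th - PI) / 2)) with (- ((th - PI) / 2)) by ring.
    apply C_ext; unfold Cmult, Cminus, Cplus, Copp, cis, RtoC; simpl;
      rewrite !cos_neg, !sin_neg, G1, G2, ?Hc, ?Hsn; ring.
Qed.

(** On the unit circle [(1 - z)^(-d)] has argument [s d (PI - th)/2] and modulus at
    most [(th/2)^(-d)]: its distance to the ray of argument [s d PI/2] is
    [O(th^(1-d))]. *)
Lemma cpower_circle s d th : is_sign s -> 0 < d < 1 -> 0 < th <= 1 ->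
  exists r, exp (- d * ln th) <= r /\
    Cmod (Cminus (cpower (Cminus (RtoC 1) (cis (s * th))) (- d))
            (Cmult (RtoC r) (cis (s * (PI * d / 2)))))
    <= 2 * exp ((1 - d) * ln (th / 2)).
Proof.
  intros Hs Hd Hth.
  assert (HPI := PI_RGT_0); assert (HPI2 := PI2_1); unfold PI2 in HPI2.
  assert (Hlow := sin_lower_bound (th / 2) ltac:(lra)).
  assert (Hup := sin_lt_x (th / 2) ltac:(lra)).
  set (m := 2 * sin (th / 2)).
  assert (Hm : th / 2 <= m <= th) by (unfold m; lra).
  exists (exp (- d * ln m)); split; [apply exp_ln_antimono; lra|].
  rewrite (chord_polar s th Hs), cpower_polar.
  2: fold m; lra.
  2: destruct Hs as [->| ->]; lra.
  fold m.
  replace (- d * (s * ((th - PI) / 2))) with (s * (PI * d / 2) + - (s * (d * th / 2)))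
    by field.
  rewrite cis_plus.
  replace (Cminus _ _) with
    (Cmult (Cmult (RtoC (exp (- d * ln m))) (cis (s * (PI * d / 2))))
       (Cminus (cis (- (s * (d * th / 2)))) (RtoC 1))) by ring.
  rewrite !Cmod_mult, Cmod_cis, Cmod_R, Rabs_pos_eq, Rmult_1_r by (left; apply exp_pos).
  assert (Hc := Cmod_cis_minus_1 (- (s * (d * th / 2)))).
  assert (Habs : Rabs (- (s * (d * th / 2))) <= th).
  { rewrite Rabs_Ropp; apply Rabs_le; destruct Hs as [->| ->]; nra. }
  apply Rle_trans with (exp (- d * ln (th / 2)) * th).
  - apply Rmult_le_compat; try lra.
    + left; apply exp_pos.
    + apply Cmod_ge_0.
    + apply exp_ln_antimono; lra.
  - right; replace ((1 - d) * ln (th / 2)) with (ln (th / 2) + - d * ln (th / 2)) by ring.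
    rewrite exp_plus, exp_ln by lra; field.
Qed.

(** Turns the two bounds of [cpower_circle] into a threshold for [th]. *)
Lemma ln_small K M eps d : 0 < K -> 0 < eps -> 0 < d < 1 ->
  exists eta, 0 < eta <= 1 /\ forall th, 0 < th < eta ->
    M < K * exp (- d * ln th) /\ K * (2 * exp ((1 - d) * ln (th / 2))) < eps.
Proof.
  intros HK Heps Hd.
  set (M' := Rmax M 1 / K).
  assert (HM' : 0 < M').
  { apply Rdiv_lt_0_compat; [|exact HK]; assert (H := Rmax_r M 1); lra. }
  set (e := eps / (2 * K)).
  assert (He : 0 < e) by (apply Rdiv_lt_0_compat; lra).
  exists (Rmin 1 (Rmin (exp (- (ln M' / d))) (exp (ln e / (1 - d))))).
  split.
  { split; [|apply Rmin_l].
    apply Rmin_pos; [lra|apply Rmin_pos; apply exp_pos]. }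
  intros th [Hth0 Hth].
  assert (H1 := Rlt_le_trans _ _ _ Hth (Rmin_r _ _)).
  assert (H2 := Rlt_le_trans _ _ _ H1 (Rmin_l _ _)).
  assert (H3 := Rlt_le_trans _ _ _ H1 (Rmin_r _ _)).
  split.
  - apply Rle_lt_trans with (K * M').
    { unfold M'; replace (K * (Rmax M 1 / K)) with (Rmax M 1) by (field; lra).
      apply Rmax_l. }
    apply Rmult_lt_compat_l; [exact HK|].
    rewrite <- (exp_ln M' HM') at 1; apply exp_increasing.
    apply ln_increasing in H2; [|exact Hth0]; rewrite ln_exp in H2.
    apply Rmult_lt_compat_l with (r := d) in H2; [|lra].
    replace (d * - (ln M' / d)) with (- ln M') in H2 by (field; lra); lra.
  - apply Rmult_lt_reg_l with (/ (2 * K)); [apply Rinv_0_lt_compat; lra|].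
    replace (/ (2 * K) * (K * (2 * exp ((1 - d) * ln (th / 2)))))
      with (exp ((1 - d) * ln (th / 2))) by (field; lra).
    replace (/ (2 * K) * eps) with e by (unfold e; field; lra).
    rewrite <- (exp_ln e He); apply exp_increasing.
    assert (H4 : th / 2 < exp (ln e / (1 - d))) by lra.
    apply ln_increasing in H4; [|lra]; rewrite ln_exp in H4.
    apply Rmult_lt_compat_l with (r := 1 - d) in H4; [|lra].
    replace ((1 - d) * (ln e / (1 - d))) with (ln e) in H4 by (field; lra); exact H4.
Qed.

Lemma cis_neq_1 t : 0 < t < 2 * PI -> cis t <> RtoC 1.
Proof.
  intros Ht E; injection E; intros _ Hc.
  assert (H := cos_2a_sin (t / 2)).
  replace (2 * (t / 2)) with t in H by field.
  assert (Hs : 0 < sin (t / 2)) by (apply sin_gt_0; lra).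
  nra.
Qed.

Lemma cis_sign_neq_1 s t : is_sign s -> 0 < t < 2 * PI -> cis (s * t) <> RtoC 1.
Proof.
  intros [->| ->] Ht.
  - rewrite Rmult_1_l; now apply cis_neq_1.
  - intros E; apply (cis_neq_1 t Ht).
    injection E; intros E2 E1.
    replace (-1 * t) with (- t) in E1, E2 by ring.
    rewrite cos_neg in E1; rewrite sin_neg in E2.
    unfold cis, RtoC; f_equal; lra.
Qed.

Lemma cis_closed_disk t : closed_disk (cis t).
Proof. unfold closed_disk; rewrite Cmod_cis; lra. Qed.

Lemma cis_period_opp t : cis (2 * PI - t) = cis (-1 * t).
Proof.
  replace (2 * PI - t) with (- t + 2 * PI) by ring.
  replace (-1 * t) with (- t) by ring.
  unfold cis; rewrite cos_plus, sin_plus, cos_2PI, sin_2PI; f_equal; ring.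
Qed.

Lemma dist_to_bounds (z w : C) (E : C -> Prop) :
  E w -> 0 <= dist_to z E <= Cmod (Cminus z w).
Proof.
  intros Hw; unfold dist_to.
  destruct (Glb_Rbar_correct (fun r => exists w : C, E w /\ r = Cmod (Cminus z w)))
    as [Hlb Hglb].
  assert (H1 := Hlb _ (ex_intro _ w (conj Hw eq_refl))).
  assert (H2 : Rbar_le 0 (Glb_Rbar (fun r => exists w : C, E w /\ r = Cmod (Cminus z w)))).
  { apply Hglb; intros r [w' [_ ->]]; apply Cmod_ge_0. }
  destruct (Glb_Rbar _); simpl in *; [lra|contradiction|contradiction].
Qed.

Lemma asymptotic_along_ray (F : (R -> Prop) -> Prop) {FF : Filter F}
    (gamma : R -> C) p u (L : C -> Prop) :
  Cmod u = 1 ->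
  (forall t, L (Cplus p (Cmult (RtoC t) u))) ->
  (forall eps M, 0 < eps -> F (fun th => exists r, M < r /\
     Cmod (Cminus (gamma th) (Cplus p (Cmult (RtoC r) u))) < eps)) ->
  asymptotic_along F gamma L.
Proof.
  intros Hu HL Hray; split.
  - intros P [M HP]; unfold filtermap.
    generalize (Hray 1 (Rmax 0 (M + Cmod p + 1)) Rlt_0_1).
    apply filter_imp; intros th [r [Hr H]]; apply HP.
    assert (R1 := Rmax_l 0 (M + Cmod p + 1)); assert (R2 := Rmax_r 0 (M + Cmod p + 1)).
    set (e := Cminus (gamma th) (Cplus p (Cmult (RtoC r) u))) in *.
    assert (T : Cmod (Cmult (RtoC r) u) <= Cmod (gamma th) + (Cmod e + Cmod p)).
    { replace (Cmult (RtoC r) u) with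
        (Cplus (gamma th) (Cplus (Copp e) (Copp p))) by (unfold e; ring).
      eapply Rle_trans; [apply Cmod_triangle|apply Rplus_le_compat_l].
      eapply Rle_trans; [apply Cmod_triangle|rewrite !Cmod_opp; lra]. }
    rewrite Cmod_mult, Hu, Cmod_R, Rabs_pos_eq in T by lra; lra.
  - apply filterlim_locally; intros eps.
    generalize (Hray eps 0 (cond_pos eps)).
    apply filter_imp; intros th [r [_ H]].
    assert (Hd := dist_to_bounds (gamma th) _ L (HL r)).
    unfold ball; simpl; unfold AbsRing_ball, abs, minus, plus, opp; simpl.
    apply Rabs_def1; lra.
Qed.

(** * The sector theorem *)

Lemma cpower_side_neg s d w : is_sign s -> 0 < d < 1 -> 0 < Re w ->
  side s (PI * d / 2) (RtoC 1) (cpower w (- d)) < 0.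
Proof.
  intros Hs Hd Hw; unfold cpower.
  assert (HPI := PI_RGT_0).
  assert (Hb := atan_bound (Im w / Re w)); set (t := atan _) in *.
  rewrite side_cis; unfold RtoC, Re, Im; simpl.
  set (e := exp _); assert (He : 0 < e) by apply exp_pos.
  match goal with |- ?X < 0 =>
    replace X with (- (e * - (s * sin (- d * t - s * (PI * d / 2))))) by ring end.
  assert (H : 0 < - (s * sin (- d * t - s * (PI * d / 2)))).
  { destruct Hs as [->| ->].
    - rewrite <- Ropp_mult_distr_r_reverse, <- sin_neg, Rmult_1_l.
      apply sin_gt_0; nra.
    - replace (- (-1 * sin (- d * t - -1 * (PI * d / 2))))
        with (sin (- d * t - -1 * (PI * d / 2))) by ring.
      apply sin_gt_0; nra. }
  assert (H1 := Rmult_lt_0_compat _ _ He H); lra.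
Qed.

Lemma unit_disk_neq_1 z : unit_disk z -> z <> RtoC 1.
Proof. unfold unit_disk; intros H ->; rewrite Cmod_1 in H; lra. Qed.

(** Every point of the unit circle is a limit of points of the disk, so a limit of [f]
    there is approximated by values of [f]. *)
Lemma within_unit_disk_proper t :
  forall P, within unit_disk (locally (T := C_UniformSpace) (cis t)) P ->
  exists z, unit_disk z /\ P z.
Proof.
  intros P HP; apply locally_Cmod in HP; destruct HP as [eps [He HP]].
  set (r := Rmin (eps / 2) (/ 2)).
  assert (Hr : 0 < r) by (apply Rmin_pos; lra).
  assert (Hr1 := Rmin_l (eps / 2) (/ 2)); assert (Hr2 := Rmin_r (eps / 2) (/ 2)).
  fold r in Hr1, Hr2.
  assert (Hz : unit_disk (Cmult (RtoC (1 - r)) (cis t))).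
  { unfold unit_disk; rewrite Cmod_mult, Cmod_cis, Cmod_R, Rabs_pos_eq; lra. }
  exists (Cmult (RtoC (1 - r)) (cis t)); split; [exact Hz|].
  apply HP; [|exact Hz].
  replace (Cminus _ _) with (Cmult (RtoC (- r)) (cis t)).
  - rewrite Cmod_mult, Cmod_cis, Cmod_R, Rabs_Ropp, Rabs_pos_eq; lra.
  - unfold Cminus, Cmult, Cplus, Copp, RtoC; simpl; f_equal; ring.
Qed.

(** A convex image cannot cross an edge of the sector: the midpoint of a value beyond
    the edge and of a far value near the edge would be a far value beyond the edge,
    whereas far values are taken near [1], where they lie inside the sector up to a
    small error. *)
Lemma convex_image_in_side f fb p K d s :
  is_sign s -> 0 < d < 1 -> 0 < K ->
  convex_domain (image_of_disk f) ->
  (forall z, unit_disk z -> f z = fb z) ->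
  (forall eps, 0 < eps -> exists eta, 0 < eta /\
     forall z, closed_disk z -> z <> RtoC 1 -> Cmod (Cminus (RtoC 1) z) < eta ->
       Cmod (Cminus (fb z)
               (Cplus p (Cmult (RtoC K) (cpower (Cminus (RtoC 1) z) (- d))))) < eps) ->
  (forall eta, 0 < eta -> exists M,
     forall z, unit_disk z -> eta <= Cmod (Cminus (RtoC 1) z) -> Cmod (f z) <= M) ->
  approaches_ray (image_of_disk f) p (cis (s * (PI * d / 2))) ->
  forall w, image_of_disk f w -> side s (PI * d / 2) (RtoC 1) (Cminus w p) < 0.
Proof.
  intros Hs Hd HK [Hopen [_ Hconv]] Hfb Hvertex Hgrowth Hray.
  set (l := side s (PI * d / 2) (RtoC 1)).
  assert (Hlb : forall x, Rabs (l x) <= Cmod x).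
  { intros x; eapply Rle_trans; [now apply side_bound|rewrite Cmod_1; lra]. }
  assert (Hle : forall w, image_of_disk f w -> l (Cminus w p) <= 0).
  { intros w0 Hw0; apply Rnot_lt_le; intros Hh.
    set (h := l (Cminus w0 p)) in *.
    destruct (Hvertex (h / 8) ltac:(lra)) as [eta [Heta Hv]].
    destruct (Hgrowth eta Heta) as [M HM].
    destruct (Hray (h / 8) (Rmax 0 (2 * M + Cmod w0 + Cmod p + h / 8)) ltac:(lra))
      as [w1 [r [Hw1 [Hr He]]]].
    assert (R1 := Rmax_l 0 (2 * M + Cmod w0 + Cmod p + h / 8)).
    assert (R2 := Rmax_r 0 (2 * M + Cmod w0 + Cmod p + h / 8)).
    set (u := cis (s * (PI * d / 2))) in *.
    set (e1 := Cminus w1 (Cplus p (Cmult (RtoC r) u))) in *.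
    assert (Hu : l u = 0).
    { unfold l, u; rewrite <- (Cmult_1_l (cis _)), side_cis.
      replace (_ - _) with 0 by ring; rewrite sin_0.
      unfold RtoC, Re, Im; simpl; ring. }
    assert (Hl1 : l (Cminus w1 p) = l e1).
    { replace (Cminus w1 p) with (Cplus (Cmult (RtoC r) u) e1) by (unfold e1; ring).
      unfold l; rewrite side_plus, side_scal; fold l; rewrite Hu; ring. }
    set (w := Cplus (Cmult (RtoC (1 - / 2)) w0) (Cmult (RtoC (/ 2)) w1)).
    assert (Hw : image_of_disk f w) by (apply Hconv; [exact Hw0|exact Hw1|lra]).
    assert (Hlw : l (Cminus w p) = / 2 * h + / 2 * l e1).
    { rewrite <- Hl1; unfold h, l.
      rewrite <- !side_scal, <- side_plus; f_equal; unfold w.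
      unfold Cminus, Cmult, Cplus, Copp, RtoC; simpl; f_equal; field. }
    assert (Hbig : M < Cmod w).
    { assert (T : Cmod (Cmult (RtoC r) u)
                  <= 2 * Cmod w + (Cmod w0 + (Cmod p + Cmod e1))).
      { replace (Cmult (RtoC r) u) with
          (Cplus (Cmult (RtoC 2) w) (Cplus (Copp w0) (Cplus (Copp p) (Copp e1)))).
        - eapply Rle_trans; [apply Cmod_triangle|].
          rewrite Cmod_mult, Cmod_R, Rabs_pos_eq by lra; apply Rplus_le_compat_l.
          eapply Rle_trans; [apply Cmod_triangle|rewrite Cmod_opp; apply Rplus_le_compat_l].
          eapply Rle_trans; [apply Cmod_triangle|rewrite !Cmod_opp; lra].
        - unfold w, e1, Cminus, Cmult, Cplus, Copp, RtoC; simpl; f_equal; field. }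
      unfold u in T; rewrite Cmod_mult, Cmod_cis, Cmod_R, Rabs_pos_eq in T by lra; lra. }
    destruct Hw as [z [Hz Hfz]].
    assert (Hnear : Cmod (Cminus (RtoC 1) z) < eta).
    { apply Rnot_le_lt; intros Hfar; assert (H := HM z Hz Hfar).
      rewrite Hfz in H; lra. }
    assert (Hz1 := unit_disk_neq_1 z Hz).
    assert (Hzc : closed_disk z) by (unfold closed_disk, unit_disk in *; lra).
    assert (Hclose := Hv z Hzc Hz1 Hnear).
    rewrite <- (Hfb z Hz), Hfz in Hclose.
    set (c := cpower (Cminus (RtoC 1) z) (- d)) in *.
    assert (Hneg : l c < 0) by (apply cpower_side_neg; auto; now apply closed_disk_Re).
    set (e2 := Cminus w (Cplus p (Cmult (RtoC K) c))) in *.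
    assert (Hlw2 : l (Cminus w p) = K * l c + l e2).
    { unfold l; rewrite <- side_scal, <- side_plus; f_equal; unfold e2; ring. }
    assert (B1 := Hlb e1); assert (B2 := Hlb e2).
    apply Rabs_le_between in B1; apply Rabs_le_between in B2; nra. }
  intros w Hw; destruct (Hle w Hw) as [Hlt|H0]; [exact Hlt|exfalso].
  (* On the edge itself, openness provides a point beyond it. *)
  destruct (proj1 (locally_Cmod w _) (Hopen w Hw)) as [eps [Heps Hball]].
  set (v := Cmult (RtoC (eps / 2)) (Cmult (RtoC s) (cis (s * (PI * d / 2) + PI / 2)))).
  assert (Hss : s * s = 1) by (destruct Hs as [->| ->]; ring).
  assert (Hv : Cmod v < eps).
  { unfold v; rewrite !Cmod_mult, Cmod_cis, !Cmod_R, (Rabs_pos_eq (eps / 2)) by lra.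
    replace (Rabs s) with 1; [lra|].
    destruct Hs as [->| ->]; [now rewrite Rabs_R1|rewrite Rabs_left; lra]. }
  assert (Hin : image_of_disk f (Cplus w v)).
  { apply Hball; replace (Cminus (Cplus w v) w) with v by ring; exact Hv. }
  assert (H := Hle _ Hin).
  replace (Cminus (Cplus w v) p) with (Cplus (Cminus w p) v) in H by ring.
  unfold l in H; rewrite side_plus in H; fold l in H; rewrite H0 in H.
  assert (Hlv : l v = eps / 2).
  { unfold l, v; rewrite side_scal, side_cis.
    replace (s * (PI * d / 2) + PI / 2 - s * (PI * d / 2)) with (PI / 2) by ring.
    rewrite cos_PI2, sin_PI2; unfold RtoC, Re, Im; simpl.
    transitivity (eps / 2 * (s * s)); [ring|rewrite Hss; ring]. }
  lra.
Qed.

Theorem theorem1p3 :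
  forall a b c delta : R,
    0 < a -> 0 < b -> 0 < c ->
    delta = a + b - c -> 0 < delta < 1 ->
    let f := shifted_hyp2F1 a b c in
    convex_function f ->
    let B := RtoC (Gamma c * Gamma (- delta) * (rGamma (c - a) * rGamma (c - b))) in
    let S := sector B (RtoC 1) (PI * delta / 2) in
    subset (image_of_disk f) S /\
    (forall z : C, boundary S z -> exists L : C -> Prop, asymptotic_line f L /\ L z) /\
    optimal_sector (image_of_disk f) B (RtoC 1) (PI * delta / 2).
Proof.
  intros a b c d Ha Hb Hc Hdef Hd f Hf B S.
  destruct (boundary_behaviour a b c d Ha Hb Hc Hd ltac:(lra))
    as [K [fb [HK [Hfb [Hcont [Hvertex Hgrowth]]]]]].
  fold f in Hfb, Hgrowth; fold B in Hvertex.
  assert (HPI := PI_RGT_0); assert (HPI2 := PI2_1); unfold PI2 in HPI2.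
  set (al := PI * d / 2) in *.
  assert (Hal : 0 < al < PI / 2) by (unfold al; nra).
  set (gamma := fun th => fb (cis th)).
  assert (Hgamma : forall th, cis th <> RtoC 1 ->
    filterlim f (within unit_disk (locally (T := C_UniformSpace) (cis th)))
      (locally (T := C_UniformSpace) (gamma th))).
  { intros th Hth P HP.
    generalize (Hcont (cis th) (cis_closed_disk th) Hth P HP).
    unfold filtermap, within; apply filter_imp; intros z HPz Hz.
    rewrite Hfb by exact Hz; apply HPz; unfold closed_disk, unit_disk in *; lra. }
  assert (Hcircle : forall s eps M, is_sign s -> 0 < eps -> exists eta, 0 < eta <= 1 /\
    forall th, 0 < th < eta -> exists r, M < r /\
      Cmod (Cminus (gamma (s * th)) (Cplus B (Cmult (RtoC r) (cis (s * al))))) < eps).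
  { intros s eps M Hs Heps.
    destruct (Hvertex (eps / 2) ltac:(lra)) as [eta1 [Heta1 Hv]].
    destruct (ln_small K M (eps / 2) d HK ltac:(lra) Hd) as [eta2 [Heta2 Hln]].
    assert (M1 := Rmin_l eta1 eta2); assert (M2 := Rmin_r eta1 eta2).
    exists (Rmin eta1 eta2); split; [split; [apply Rmin_pos|]; lra|].
    intros th Hth.
    destruct (cpower_circle s d th Hs Hd ltac:(lra)) as [r [Hr Hdist]].
    destruct (Hln th ltac:(lra)) as [L1 L2].
    assert (V : Cmod (Cminus (RtoC 1) (cis (s * th))) < eta1).
    { rewrite <- Cmod_opp.
      replace (Copp (Cminus (RtoC 1) (cis (s * th))))
        with (Cminus (cis (s * th)) (RtoC 1)) by ring.
      eapply Rle_lt_trans; [apply Cmod_cis_minus_1|].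
      rewrite Rabs_mult, (Rabs_pos_eq th) by lra.
      replace (Rabs s) with 1; [lra|].
      destruct Hs as [->| ->]; [now rewrite Rabs_R1|rewrite Rabs_left; lra]. }
    assert (Hne : cis (s * th) <> RtoC 1) by (apply cis_sign_neq_1; [exact Hs|lra]).
    assert (W := Hv (cis (s * th)) (cis_closed_disk _) Hne V).
    exists (K * r); split; [nra|].
    set (q := cpower (Cminus (RtoC 1) (cis (s * th))) (- d)) in *.
    replace (Cminus (gamma (s * th)) (Cplus B (Cmult (RtoC (K * r)) (cis (s * al)))))
      with (Cplus (Cminus (fb (cis (s * th))) (Cplus B (Cmult (RtoC K) q)))
              (Cmult (RtoC K) (Cminus q (Cmult (RtoC r) (cis (s * al)))))).
    - eapply Rle_lt_trans; [apply Cmod_triangle|].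
      rewrite (Cmod_mult (RtoC K)), Cmod_R, Rabs_pos_eq by lra.
      apply Rmult_le_compat_l with (r := K) in Hdist; [|lra].
      unfold al; lra.
    - unfold gamma; rewrite RtoC_mult; ring. }
  assert (Hray : forall s, is_sign s ->
    approaches_ray (image_of_disk f) B (cis (s * al))).
  { intros s Hs eps M Heps.
    destruct (Hcircle s (eps / 2) M Hs ltac:(lra)) as [eta [Heta Hth]].
    destruct (Hth (eta / 2) ltac:(lra)) as [r [Hr He]].
    assert (Hne : cis (s * (eta / 2)) <> RtoC 1)
      by (apply cis_sign_neq_1; [exact Hs|lra]).
    assert (HP : locally (T := C_UniformSpace) (gamma (s * (eta / 2)))
              (fun w => Cmod (Cminus w (gamma (s * (eta / 2)))) < eps / 2)).
    { apply locally_Cmod; exists (eps / 2); split; [lra|auto]. }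
    destruct (within_unit_disk_proper _ _ (Hgamma _ Hne _ HP)) as [z [Hz Hfz]].
    exists (f z), r; split; [now exists z|split; [exact Hr|]].
    replace (Cminus (f z) _) with
      (Cplus (Cminus (f z) (gamma (s * (eta / 2))))
         (Cminus (gamma (s * (eta / 2))) (Cplus B (Cmult (RtoC r) (cis (s * al))))))
      by ring.
    eapply Rle_lt_trans; [apply Cmod_triangle|lra]. }
  assert (H1 : RtoC 1 <> RtoC 0) by (intros E; injection E; lra).
  split; [|split].
  - intros w Hw; apply (sector_sides B (RtoC 1) al w H1 Hal); intros s Hs.
    destruct Hf as [_ [_ [_ [_ Hconv]]]].
    apply (convex_image_in_side f fb B K d s); auto.
  - intros z Hz; destruct (sector_boundary B al z Hal Hz) as [s [t [Hs ->]]].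
    exists (fun w => exists t, w = Cplus B (Cmult (RtoC t) (cis (s * al)))).
    split; [split|now exists t].
    + exists B, (cis (s * al)); split; [|intros w; reflexivity].
      apply Cmod_gt_0; rewrite Cmod_cis; lra.
    + exists gamma; split; [intros th Hth; now apply Hgamma, cis_neq_1|].
      destruct Hs as [->| ->];
        [left; apply (asymptotic_along_ray _ gamma B (cis (1 * al)))
        |right; apply (asymptotic_along_ray _ gamma B (cis (-1 * al)))];
        try (apply Cmod_cis); try (intros t'; now exists t'); intros eps M Heps.
      * destruct (Hcircle 1 eps M (or_introl eq_refl) Heps) as [eta [Heta H]].
        exists (mkposreal eta (proj1 Heta)); intros th Hth Hpos.
        unfold ball in Hth; simpl in Hth.
        unfold AbsRing_ball, abs, minus, plus, opp in Hth; simpl in Hth.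
        apply Rabs_def2 in Hth.
        rewrite <- (Rmult_1_l th); apply H; lra.
      * (* The end at [2 PI] is the circle run backwards from [1]. *)
        destruct (Hcircle (-1) eps M (or_intror eq_refl) Heps) as [eta [Heta H]].
        exists (mkposreal eta (proj1 Heta)); intros th Hth Hpos.
        unfold ball in Hth; simpl in Hth.
        unfold AbsRing_ball, abs, minus, plus, opp in Hth; simpl in Hth.
        apply Rabs_def2 in Hth.
        replace (gamma th) with (gamma (-1 * (2 * PI - th))).
        -- apply H; lra.
        -- unfold gamma; rewrite <- cis_period_opp; do 2 f_equal; ring.
  - apply asymptotic_sector_optimal; [exact Hal|exact Hray].
Qed.
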